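(* Let $K$ be a field, let $r\geq 3$, $S=K[x_1,\ldots,x_r]$, and let $G$ be a simple graph on the vertex set $[r]=\{1,\ldots,r\}$ with $E(G)\neq\emptyset$, which may contain some isolated vertices. Let $I_G\subseteq S$ be its Stanley–Reisner ideal. Then, for all $n\geq 1$, $$\text{g-reg}(S/I_G^{n})=\begin{cases}3n-1, & \mathrm{girth}(G)=3;\\ 2n, & \mathrm{girth}(G)=4;\\ 2n-1, & 5\leq \mathrm{girth}(G)<\infty \text{ and } n\geq 2;\\ 2, & 5\leq \mathrm{girth}(G)<\infty \text{ and } n=1;\\ 2n-1, & \mathrm{girth}(G)=\infty \text{ and } \deg(G)\geq 2;\\ 2n-1, & \deg(G)=1.\end{cases}$$
   Context: $S=K[x_1,\ldots,x_r]$ is standard graded with maximal homogeneous ideal $\mathfrak m=(x_1,\ldots,x_r)$. For a finitely generated graded $S$-module $M$, $a_i(M):=\max\{t: H^i_{\mathfrak m}(M)_t\neq 0\}$, where $H^i_{\mathfrak m}$ is local cohomology and $\max\emptyset=-\infty$. The geometric regularity is $\text{g-reg}(M):=\max\{a_i(M)+i: i>0\}$. A simple graph is an undirected graph with no loops and no parallel edges; $E(G)$ is its edge set. $G$ is regarded as a simplicial complex on $[r]$ whose faces are $\emptyset$, the singletons $\{i\}$ ($i\in[r]$) and the edges. Its Stanley–Reisner ideal is $I_G=(\prod_{i\in F}x_i: F\subseteq[r],\ F \text{ is not a face})$. $\deg(G)$ is the maximal degree of the vertices of $G$. $\mathrm{girth}(G)$ is the smallest length of a cycle of $G$ (a triangle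 has length $3$), with $\mathrm{girth}(G)=\infty$ if $G$ contains no cycles. *)

(* Defs.v *)
From HB Require Import structures.
From mathcomp Require Import all_boot all_order all_algebra.
From mathcomp Require Import mpoly.

Set Implicit Arguments.
Unset Strict Implicit.
Unset Printing Implicit Defensive.

Import GRing.Theory.
Local Open Scope ring_scope.

(* Ideals of S = K[x_1,...,x_r] are Prop-valued predicates on {mpoly K[r]};
   the variables are indexed by 'I_r. *)

Section Ideals.
Variables (K : fieldType) (r : nat).
Notation S := {mpoly K[r]}.

Definition ideal_gen (A : S -> Prop) : S -> Prop :=
  fun p => exists2 s : seq (S * S),
    (forall c, c \in s -> A c.2) & p = \sum_(c <- s) c.1 * c.2.

Definition ideal_pow (I : S -> Prop) (n : nat) : S -> Prop :=
  ideal_gen (fun q => exists2 f : 'I_n -> S,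
    (forall i, I (f i)) & q = \prod_(i < n) f i).

Definition xmon (F : {set 'I_r}) : S := \prod_(i in F) 'X_i.

(* The degree is an integer so that the components of negative degree are the
   zero space; the zero polynomial lies in every component. *)
Definition homogz (t : int) : S -> Prop :=
  fun p => forall m, m \in msupp p -> (mdeg m)%:Z = t.

End Ideals.

Section LocalCohomology.
Variables (K : fieldType) (r : nat).
Notation S := {mpoly K[r]}.

(* Local cohomology of S/J with support in (x_1,...,x_r), for J a homogeneous
   ideal, is the cohomology of the Cech complex
     C^i = \bigoplus_(F : #|F| = i) (S/J)_{x_F},   x_F = \prod_(j in F) x_j.
   The localization S_{x_F} is taken inside the fraction field of S, and
   (S/J)_{x_F} = S_{x_F} / J S_{x_F}: a cochain is given by representatives in
   S_{x_F}, and equalities in C^i are congruences modulo J S_{x_F}. *)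

Definition mkfrac (F : {set 'I_r}) (p : S) (k : nat) : {fraction S} :=
  tofrac p / tofrac (xmon K F ^+ k).

Definition loc_deg (F : {set 'I_r}) (t : int) : {fraction S} -> Prop :=
  fun y => exists p k, homogz (t + (k * #|F|)%:Z) p /\ y = mkfrac F p k.

Definition loc_ideal (J : S -> Prop) (F : {set 'I_r}) : {fraction S} -> Prop :=
  fun y => exists p k, J p /\ y = mkfrac F p k.

Definition cech_d (c : {set 'I_r} -> {fraction S}) (F : {set 'I_r}) :
    {fraction S} :=
  \sum_(j in F) (-1) ^+ #|[set l in F | (l < j)%N]| * c (F :\ j).

Definition cocycle (J : S -> Prop) (i : nat) (t : int)
    (c : {set 'I_r} -> {fraction S}) : Prop :=
  (forall F : {set 'I_r}, #|F| = i -> loc_deg F t (c F)) /\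
  (forall F : {set 'I_r}, #|F| = i.+1 -> loc_ideal J F (cech_d c F)).

(* For i = 0 the condition on b is void and cech_d b set0 = 0, in accordance
   with C^{-1} = 0. *)
Definition coboundary (J : S -> Prop) (i : nat) (t : int)
    (c : {set 'I_r} -> {fraction S}) : Prop :=
  exists2 b : {set 'I_r} -> {fraction S},
    forall F : {set 'I_r}, #|F|.+1 = i -> loc_deg F t (b F) &
    forall F : {set 'I_r}, #|F| = i -> loc_ideal J F (c F - cech_d b F).

(* H^i_m(S/J)_t <> 0 *)
Definition lc_neq0 (J : S -> Prop) (i : nat) (t : int) : Prop :=
  exists2 c, cocycle J i t c & ~ coboundary J i t c.

(* m = max A, where None stands for -oo = max of the empty set. *)
Definition is_max (A : int -> Prop) (m : option int) : Prop :=
  if m is Some v then A v /\ (forall t, A t -> t <= v)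
  else forall t, ~ A t.

(* a_i(S/J) = a *)
Definition is_a_inv (J : S -> Prop) (i : nat) (a : option int) : Prop :=
  is_max (lc_neq0 J i) a.

(* g-reg(S/J) = v; this includes the existence of a_i(S/J) for all i > 0. *)
Definition is_greg (J : S -> Prop) (v : option int) : Prop :=
  exists2 a : nat -> option int,
    forall i, (0 < i)%N -> is_a_inv J i (a i) &
    is_max (fun s => exists i b,
      [/\ (0 < i)%N, a i = Some b & s = b + i%:Z]) v.

End LocalCohomology.

(* A simple graph on 'I_r is a relation e with symmetric e and irreflexive e,
   which are hypotheses of the theorem. *)
Section Graphs.
Variables (r : nat) (e : rel 'I_r).

Definition graph_face (F : {set 'I_r}) : bool :=
  (#|F| <= 1)%N || [exists i, exists j, e i j && (F == [set i; j])].

Definition sr_ideal (K : fieldType) : {mpoly K[r]} -> Prop :=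
  ideal_gen (fun q => exists2 F : {set 'I_r}, ~~ graph_face F & q = xmon K F).

Definition graph_deg : nat := \max_(i < r) #|[set j | e i j]|.

Definition has_cycle (k : nat) : bool :=
  (3 <= k)%N && [exists c : k.-tuple 'I_r, ucycleb e c].

(* None stands for infinity; a cycle has no repeated vertex, hence length at
   most r. *)
Definition girth : option nat := ohead [seq k <- iota 0 r.+1 | has_cycle k].

End Graphs.

(* Main.v *)
Require Import Defs.
From HB Require Import structures.
From mathcomp Require Import all_boot all_order all_algebra.
From mathcomp Require Import mpoly.
From mathcomp Require Import zify ring.
From Stdlib Require Import ClassicalEpsilon.

Set Implicit Arguments.
Unset Strict Implicit.
Unset Printing Implicit Defensive.

Import Order.TTheory GRing.Theory Num.Theory.
Local Open Scope ring_scope.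

(** The quotient [S/I^n] by a monomial ideal is graded by integer vectors [a],
    and so is its Cech complex.  In degree [a] the component of
    [(S/I^n)_(x_F)] is the field [K] when every negative coordinate of [a] lies
    in [F] and [x^a] is not in [I^n S_(x_F)], and zero otherwise.  The sets [F]
    of the first kind form a degree complex, and [H^i] in degree [a] is the
    cohomology of a cochain complex of scalars indexed by it
    ([cohom_of_lc_neq0], [lc_neq0_of_cohom]).  This is the idea of Takayama's
    formula; the geometric regularity becomes the maximum of [|a| + i] over
    [i > 0] and the degrees [a] with nonzero [H^i].

    For the ideal [I] of a graph the faces of the degree complex are faces of
    the graph, so only [i = 1] and [i = 2] matter.  Since every triple of
    vertices is a nonface, an edge [ij] belongs to the degree complex exactly
    when [a] has weight less than [n] outside [ij].  A vertex [v] that belongs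
    to it without any edge at [v], called bare below, satisfies a further
    inequality: the weight of its neighbours plus twice the weight of its
    non-neighbours is less than [2n].  Otherwise a greedy choice of [n] nonfaces
    through [v] would put [x^a] in [I^n S_(x_v)] ([in_pow_star]).

    A nonzero [H^2] comes either from a degree [a] with negative coordinates,
    giving [|a| <= 2n - 3], or from a cycle in the degree complex of a
    nonnegative [a], because forests have no first cohomology
    ([forest_potential]).  Adding the edge inequalities along a cycle gives
    [|a| <= 3n - 3] for length 3, [|a| <= 2n - 2] for length at least 4, and
    [|a| <= 2n - 3] for length at least 5 and [n >= 2].  A nonzero [H^1] comes
    from a bare vertex where [a] is negative, or from two vertices of the degree complex that are not
    connected in it; combining the vertex and edge inequalities gives
    [|a| <= 3n - 2] always, [|a| <= 2n - 1] without triangles and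
    [|a| <= 2n - 2] without triangles and 4-cycles ([H1_bounded]).

    These bounds are attained.  With the entries [n - 1] on the vertices of a
    triangle, or on two opposite vertices of a 4-cycle, that cycle is in the
    degree complex.  For [n = 1] and [a = 0] the degree complex is the graph.  A
    path [j v k] gives [2n - 3] in [H^2], with [a] equal to [-1] at [v] and
    [n - 1] at [j] and [k].  If the graph is a matching, the entry [n - 1] at
    an end of an edge and at a third vertex gives [2n - 2] in [H^1]. *)

(** * Degreewise computation of local cohomology of monomial ideals *)

Section Degreewise.
Variables (r : nat).
Implicit Types (a : 'I_r -> int) (F : {set 'I_r}) (m : 'X_{1..r}).

Definition indic_mnm F : 'X_{1..r} := [multinom (i \in F : nat) | i < r].

Definition neg_in a F := forall j, j \notin F -> 0 <= a j.

(** Membership of the Laurent monomial [x^a] in the localization at [x_F] of the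
    monomial ideal whose monomials are those satisfying [M]. *)
Definition in_loc (M : 'X_{1..r} -> Prop) a F :=
  exists k m, M m /\ forall j, (m j)%:Z = a j + (k * (j \in F))%:Z.

Definition deg_face M a F := neg_in a F /\ ~ in_loc M a F.

(** The exponent of the Laurent monomial [x^m / (x_1 ... x_r)^N].  All cochains
    are brought to such a denominator, so that the fractions at play are
    compared through polynomials. *)
Definition shift_exp N m : 'I_r -> int := fun j => (m j)%:Z - N%:Z.

Lemma neg_inS a F F' : F \subset F' -> neg_in a F -> neg_in a F'.
Proof. by move=> /subsetP sF h j jF'; apply: h; apply: contra jF'; apply: sF. Qed.

Variable K : fieldType.
Notation S := {mpoly K[r]}.
Implicit Types (p R : S) (z w : {set 'I_r} -> K).

Definition scal_d z F : K :=
  \sum_(j in F) (-1) ^+ #|[set l in F | (l < j)%N]| * z (F :\ j).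

(** Nonvanishing of the [i]-th cohomology of the degree [a] part of the Cech
    complex.  Cochains live on the sets containing the negative coordinates of
    [a], and equations are only required on faces of the degree complex, the
    quotient being zero elsewhere. *)
Definition cohom_neq0 M a i := exists z,
  [/\ forall F, #|F| = i -> ~ neg_in a F -> z F = 0,
      forall F, #|F| = i.+1 -> deg_face M a F -> scal_d z F = 0
    & ~ exists2 w, forall F, #|F|.+1 = i -> ~ neg_in a F -> w F = 0 &
        forall F, #|F| = i -> deg_face M a F -> z F = scal_d w F].

Lemma xmonXE F k : xmon K F ^+ k = 'X_[indic_mnm F *+ k].
Proof.
rewrite -mpolyXn; congr (_ ^+ k); rewrite mpolyXE_id /xmon big_mkcond /=.
by apply: eq_bigr => i _; rewrite mnmE; case: (i \in F).
Qed.

Lemma tofracX_neq0 m : tofrac ('X_[m] : S) != 0.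
Proof. by rewrite tofrac_eq0 -msupp_eq0 msuppX. Qed.

Lemma eq_mkfrac F p k G q l :
  mkfrac F p k = mkfrac G q l <->
  p * 'X_[indic_mnm G *+ l] = q * 'X_[indic_mnm F *+ k].
Proof.
rewrite /mkfrac !xmonXE; split.
  move/eqP; rewrite eqr_div ?tofracX_neq0 // -!tofracM.
  by rewrite tofrac_eq => /eqP.
by move=> h; apply/eqP; rewrite eqr_div ?tofracX_neq0 // -!tofracM h.
Qed.

Lemma mkfracB F p q k : mkfrac F (p - q) k = mkfrac F p k - mkfrac F q k.
Proof. by rewrite /mkfrac tofracB mulrBl. Qed.

Lemma msuppMXP p m m' :
  m' \in msupp (p * 'X_[m]) -> exists2 m0, m0 \in msupp p & m' = (m + m0)%MM.
Proof. by rewrite (perm_mem (msuppMX _ _)) => /mapP. Qed.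

Lemma supp_of_frac F R N p k m :
  mkfrac setT R N = mkfrac F p k -> m \in msupp R ->
  exists2 m', m' \in msupp p &
    (m' + indic_mnm setT *+ N = m + indic_mnm F *+ k)%MM.
Proof.
move=> /eq_mkfrac h mR.
have: (indic_mnm F *+ k + m)%MM \in msupp (R * 'X_[indic_mnm F *+ k]).
  by rewrite (perm_mem (msuppMX _ _)) map_f.
rewrite h => /msuppMXP [m' m'p e]; exists m' => //.
by rewrite addmC -e addmC.
Qed.

(** Converse of [supp_of_frac]: a change of denominator can be performed as
    soon as it is possible on each monomial, any property [Q] of the resulting
    monomials being kept. *)
Lemma frac_of_supp F R N k (Q : 'X_{1..r} -> Prop) :
  (forall m, m \in msupp R -> exists2 m', Q m' &
    (m' + indic_mnm setT *+ N = m + indic_mnm F *+ k)%MM) ->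
  exists2 p, forall m, m \in msupp p -> Q m &
    mkfrac setT R N = mkfrac F p k.
Proof.
move=> h.
exists (\sum_(m <- msupp R)
   R@_m *: 'X_[(m + indic_mnm F *+ k) - indic_mnm setT *+ N]%MM).
  move=> m' /msupp_sum_le /flattenP [s /mapP [m]].
  rewrite filter_predT => /h [m0 Qm0 e] -> /msuppZ_le.
  by rewrite msuppX inE => /eqP ->; rewrite -e addmK.
apply/eq_mkfrac; rewrite {1}(mpolyE R) !mulr_suml.
rewrite big_seq [RHS]big_seq; apply: eq_bigr => m /h [m0 _ e].
by rewrite -!scalerAl -!mpolyXD -e addmK.
Qed.

Lemma shift_exp_eq F N k m m' :
  (m' + indic_mnm setT *+ N = m + indic_mnm F *+ k)%MM <->
  forall j, (m' j)%:Z = shift_exp N m j + (k * (j \in F))%:Z.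
Proof.
split=> [/mnmP h j|h]; last apply/mnmP => j; move: (h j); rewrite /shift_exp.
  rewrite !mnmDE !mulmnE !mnmE in_setT; lia.
rewrite !mnmDE !mulmnE !mnmE in_setT; lia.
Qed.

Lemma sum_shift F N k m m' :
  (forall j, (m' j)%:Z = shift_exp N m j + (k * (j \in F))%:Z) ->
  (mdeg m')%:Z = \sum_j shift_exp N m j + (k * #|F|)%:Z.
Proof.
move=> h; have -> : (k * #|F| = \sum_j k * (j \in F))%N.
  by rewrite -big_distrr /= -sum1_card [in LHS]big_mkcond.
rewrite mdegE !(big_morph Posz PoszD (erefl _)) -big_split /=.
by apply: eq_bigr => j _; rewrite h.
Qed.

Lemma loc_deg_frac F t R N :
  loc_deg F t (mkfrac setT R N) <->
  forall m, m \in msupp R -> neg_in (shift_exp N m) F /\ \sum_j shift_exp N m j = t.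
Proof.
split=> [[p [k [hp e]]] m mR|h].
  have [m' m'p /shift_exp_eq e'] := supp_of_frac e mR.
  have h := sum_shift e'; have := hp _ m'p; rewrite h => /addIr ->.
  split=> // j /negbTE jF; have := e' j.
  by rewrite jF muln0 addr0 => <-.
have [|p hp e] := @frac_of_supp F R N N
    (fun m' => (mdeg m')%:Z = t + (N * #|F|)%:Z); last by exists p, N.
move=> m /h [neg sm].
have e : forall j, ([multinom (m j + N * (j \in F) - N)%N | j < r] j)%:Z =
    shift_exp N m j + (N * (j \in F))%:Z.
  move=> j; rewrite mnmE /shift_exp; have := neg j; rewrite /shift_exp.
  case: (j \in F) => /=; first by lia.
  by move=> /(_ isT); lia.
exists [multinom (m j + N * (j \in F) - N)%N | j < r]; last exact/shift_exp_eq.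
by rewrite (sum_shift e) sm.
Qed.

Variables (M : 'X_{1..r} -> Prop) (J : S -> Prop).
Hypothesis MD : forall m m', M m -> M (m' + m)%MM.
Hypothesis JM : forall p, J p <-> forall m, m \in msupp p -> M m.

(** The exponent of [x_F] needed to enter the ideal depends on the monomial; the
    upward closure [MD] makes the sum of these exponents work for all the
    monomials of the support. *)
Lemma loc_ideal_frac F R N :
  loc_ideal J F (mkfrac setT R N) <->
  forall m, m \in msupp R -> in_loc M (shift_exp N m) F.
Proof.
split=> [[p [k [/JM hp e]]] m mR|h].
  have [m' m'p /shift_exp_eq e'] := supp_of_frac e mR.
  by exists k, m'; split=> //; apply: hp.
suff [k hk] : exists k, forall m, m \in msupp R -> exists2 m', M m' &
    (m' + indic_mnm setT *+ N = m + indic_mnm F *+ k)%MM.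
  have [p hp e] := frac_of_supp hk.
  by exists p, k; split=> //; apply/JM.
elim: (msupp R : seq _) h => [|m s IH] h; first by exists 0%N.
have [|k1 hk1] := IH; first by move=> m' h'; apply: h; rewrite inE h' orbT.
have [k2 [m2 [Mm2 /shift_exp_eq e2]]] := h m (mem_head _ _).
exists (k1 + k2)%N => m'; rewrite inE => /predU1P [->|/hk1 [m1 Mm1 e1]].
  exists (indic_mnm F *+ k1 + m2)%MM; first exact: MD.
  apply/mnmP => j; move/mnmP: e2 => /(_ j).
  rewrite !mnmDE !mulmnE; lia.
exists (indic_mnm F *+ k2 + m1)%MM; first exact: MD.
apply/mnmP => j; move/mnmP: e1 => /(_ j).
rewrite !mnmDE !mulmnE; lia.
Qed.

Lemma frac_denom F p k N : (k <= N)%N ->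
  exists R, mkfrac F p k = mkfrac setT R N.
Proof.
move=> kN; exists (p * 'X_[indic_mnm setT *+ N - indic_mnm F *+ k]%MM).
apply/eq_mkfrac; rewrite -mulrA -mpolyXD submK //.
apply/mnm_lepP => j; rewrite !mulmnE !mnmE in_setT.
by case: (j \in F); lia.
Qed.

Lemma common_denom (c : {set 'I_r} -> {fraction S}) (t : int) (A : pred {set 'I_r}) :
  (forall F, A F -> loc_deg F t (c F)) ->
  exists N0, forall N, (N0 <= N)%N -> exists P : {set 'I_r} -> S,
    forall F, A F -> c F = mkfrac setT (P F) N.
Proof.
move=> hc.
have /fin_all_exists [kk hkk] : forall F, exists k, A F ->
    exists p, c F = mkfrac F p k.
  move=> F; case: (boolP (A F)) => [/hc [p [k [_ e]]]|_]; last by exists 0%N.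
  by exists k => _; exists p.
exists (\max_F kk F) => N hN.
apply: (@fin_all_exists _ (fun=> S)
  (fun F R => A F -> c F = mkfrac setT R N)) => F.
case: (boolP (A F)) => [AF|_]; last by exists 0.
have [p ->] := hkk F AF.
have [|R hR] := @frac_denom F p (kk F) N; last by exists R.
by apply: leq_trans hN; apply: (leq_bigmax F).
Qed.

Definition poly_d (P : {set 'I_r} -> S) F : S :=
  \sum_(j in F) (-1) ^+ #|[set l in F | (l < j)%N]| * P (F :\ j).

Lemma cech_d_frac (c : {set 'I_r} -> {fraction S}) P N F :
  (forall j, j \in F -> c (F :\ j) = mkfrac setT (P (F :\ j)) N) ->
  cech_d c F = mkfrac setT (poly_d P F) N.
Proof.
move=> h; rewrite /cech_d /mkfrac /poly_d rmorph_sum /= mulr_suml.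
apply: eq_bigr => j /h ->.
by rewrite /mkfrac tofracM rmorph_sign mulrA.
Qed.

Lemma mcoeff_d P F m : (poly_d P F)@_m = scal_d (fun G => (P G)@_m) F.
Proof.
rewrite /poly_d raddf_sum /=; apply: eq_bigr => j _.
move: #|_| => k; rewrite -(signr_odd S k) -(signr_odd K k); case: (odd k).
  by rewrite !expr1 !mulN1r mcoeffN.
by rewrite !expr0 !mul1r.
Qed.

Lemma eq_scal_d z w F : (forall j, j \in F -> z (F :\ j) = w (F :\ j)) ->
  scal_d z F = scal_d w F.
Proof. by move=> h; apply: eq_bigr => j /h ->. Qed.

Lemma scal_d_neg z a F :
  (forall G : {set 'I_r}, #|G|.+1 = #|F| -> ~ neg_in a G -> z G = 0) ->
  ~ neg_in a F -> scal_d z F = 0.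
Proof.
move=> hz hF; apply: big1 => j jF; rewrite hz ?mulr0 //.
  by rewrite [RHS](cardsD1 j) jF.
by apply: contra_not hF; apply: neg_inS; apply: subD1set.
Qed.

Lemma cardsD1_eq F j i : j \in F -> #|F| = i.+1 -> #|F :\ j| = i.
Proof. by move=> jF; rewrite (cardsD1 j) jF => -[]. Qed.

(** A scalar cocycle [z] gives the Cech cocycle [F |-> z F * x^a].  If the latter
    were the coboundary of [b], the coefficients of [x^a] in [b] would
    exhibit [z] as a coboundary. *)
Lemma lc_neq0_of_cohom a t i : \sum_j a j = t -> cohom_neq0 M a i -> lc_neq0 J i t.
Proof.
move=> at_ [z [zneg zc znb]].
pose N0 := (\sum_j `|a j|)%N.
have N0P N j : (N0 <= N)%N -> 0 <= a j + N%:Z.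
  move=> /(leq_trans _) h; suff /h : (`|a j| <= N0)%N by lia.
  by rewrite /N0 (bigD1 j) //= leq_addr.
pose mm N : 'X_{1..r} := [multinom `|(a j + N%:Z)%R|%N | j < r].
have expoE N : (N0 <= N)%N -> shift_exp N (mm N) =1 a.
  by move=> hN j; rewrite /shift_exp mnmE; have := N0P N j hN; lia.
have negE N F : (N0 <= N)%N -> neg_in (shift_exp N (mm N)) F <-> neg_in a F.
  by move=> hN; split=> h j /h; rewrite expoE.
have locE N F : (N0 <= N)%N -> in_loc M (shift_exp N (mm N)) F <-> in_loc M a F.
  by move=> hN; split=> -[k [m [Mm h]]]; exists k, m; split=> // j; rewrite h expoE.
pose P N F := z F *: 'X_[mm N] : S.
have PE N F m : m \in msupp (P N F) -> m = mm N /\ z F <> 0.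
  rewrite mcoeff_msupp /P mcoeffZ mcoeffX; case: (mm N =P m) => [<-|_].
    by rewrite mulr1 => /eqP.
  by rewrite mulr0 eqxx.
exists (fun F => mkfrac setT (P N0 F) N0).
  split=> F hF.
    apply/loc_deg_frac => m /PE [-> nz]; split.
      apply/negE => //; apply: NNPP => h; exact/nz/zneg.
    by rewrite -at_; apply: eq_bigr => j _; rewrite expoE.
  rewrite (@cech_d_frac _ (P N0) N0) //; apply/loc_ideal_frac => m.
  rewrite mcoeff_msupp mcoeff_d => nz.
  have em : m = mm N0.
    apply: NNPP => h; move/eqP: nz; apply; apply: big1 => j _.
    by rewrite /P mcoeffZ mcoeffX; case: (mm N0 =P m) => [e|_]; [by case: h|rewrite !mulr0].
  subst m; apply/locE => //; apply: NNPP => nloc; move/eqP: nz; apply.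
  have -> : scal_d (fun G => (P N0 G)@_(mm N0)) F = scal_d z F.
    by apply: eq_scal_d => j _; rewrite /P mcoeffZ mcoeffX eqxx mulr1.
  have [hneg|hneg] := classic (neg_in a F); first by apply: zc.
  apply: scal_d_neg hneg => G; rewrite hF => -[]; exact: zneg.
case=> b hb hcb; apply: znb.
have [N1 hN1] := @common_denom b t (fun F => #|F|.+1 == i)
  (fun F h => hb F (eqP h)).
pose N := maxn N0 N1.
have hN : (N0 <= N)%N by rewrite leq_maxl.
have [Q hQ] := hN1 N (leq_maxr _ _).
have cE F : mkfrac setT (P N0 F) N0 = mkfrac setT (P N F) N.
  apply/eq_mkfrac; rewrite /P -!scalerAl -!mpolyXD; congr (_ *: 'X_[_]).
  apply/mnmP => j; rewrite !mnmDE !mulmnE !mnmE in_setT.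
  have := N0P N j hN; have := N0P N0 j (leqnn _); lia.
exists (fun F => (Q F)@_(mm N)) => F hF.
  move=> hneg; have [hQF] := (hQ F (introT eqP hF), hb F hF).
  rewrite {1}hQF => /loc_deg_frac h.
  apply/eqP; apply: contra_notT hneg; rewrite -mcoeff_msupp => /h [] hn _.
  exact/(negE N).
move=> [hneg hloc]; have := hcb F hF.
rewrite cE (@cech_d_frac _ Q N); last first.
  by move=> j jF; apply: hQ; rewrite -hF (cardsD1 j F) jF.
rewrite -mkfracB => /loc_ideal_frac h; apply/eqP; rewrite -subr_eq0.
apply/eqP/eqP; apply: contra_notT hloc => nz; apply/(locE N) => //; apply: h.
rewrite mcoeff_msupp mcoeffB mcoeff_d /P mcoeffZ mcoeffX eqxx mulr1 //.
Qed.

(** If all scalar complexes of total degree [t] were exact at [i], a Cech cocycle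
    would split into scalar cocycles, one for each of its finitely many
    multidegrees, and solving each of them would make it a coboundary. *)
Lemma cohom_of_lc_neq0 i t :
  lc_neq0 J i t -> exists2 a, \sum_j a j = t & cohom_neq0 M a i.
Proof.
case=> c [cdeg cc] cnb; apply: NNPP => hno; apply: cnb.
have exw a z : \sum_j a j = t ->
    (forall F, #|F| = i -> ~ neg_in a F -> z F = 0) ->
    (forall F, #|F| = i.+1 -> deg_face M a F -> scal_d z F = 0) ->
    exists2 w, forall F, #|F|.+1 = i -> ~ neg_in a F -> w F = 0 &
        forall F, #|F| = i -> deg_face M a F -> z F = scal_d w F.
  move=> sa h1 h2; apply: NNPP => h3; apply: hno; exists a => //.
  by exists z.
have [N /(_ N (leqnn N)) [P hP]] := @common_denom c t (fun F => #|F| == i)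
  (fun F h => cdeg F (eqP h)).
have Pdeg F m : #|F| = i -> m \in msupp (P F) ->
    neg_in (shift_exp N m) F /\ \sum_j shift_exp N m j = t.
  move=> hF; move: (cdeg F hF); rewrite hP ?hF // => /loc_deg_frac; exact.
have Pco F m : #|F| = i.+1 -> deg_face M (shift_exp N m) F ->
    scal_d (fun G => (P G)@_m) F = 0.
  move=> hF [_ hloc]; rewrite -mcoeff_d; have := cc F hF.
  rewrite (@cech_d_frac _ P N); last by move=> j jF; rewrite hP // (cardsD1_eq jF hF).
  move/loc_ideal_frac => h; apply/eqP; apply: contra_notT hloc.
  by rewrite -mcoeff_msupp; apply: h.
have [W hW] : exists W : 'X_{1..r} -> {set 'I_r} -> K, forall m,
    \sum_j shift_exp N m j = t ->
    (forall F, #|F|.+1 = i -> ~ neg_in (shift_exp N m) F -> W m F = 0) /\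
    (forall F, #|F| = i -> deg_face M (shift_exp N m) F -> (P F)@_m = scal_d (W m) F).
  suff h m : exists w, \sum_j shift_exp N m j = t ->
    (forall F, #|F|.+1 = i -> ~ neg_in (shift_exp N m) F -> w F = 0) /\
    (forall F, #|F| = i -> deg_face M (shift_exp N m) F -> (P F)@_m = scal_d w F).
    exists (fun m => proj1_sig (constructive_indefinite_description _ (h m))).
    by move=> m; case: constructive_indefinite_description.
  have [sm|nsm] := classic (\sum_j shift_exp N m j = t); last by exists (fun=> 0).
  have [|w h1 h2] := exw _ (fun F => (P F)@_m) sm _ (fun F hF => Pco F m hF).
    move=> F hF hneg; apply/eqP; apply: contra_notT hneg.
    by rewrite -mcoeff_msupp => /(Pdeg _ _ hF) [].
  by exists w.
pose L := undup (flatten [seq msupp (P F) | F <- enum {set 'I_r} & #|F| == i]).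
have LE F m : #|F| = i -> m \in msupp (P F) -> m \in L.
  move=> hF hm; rewrite mem_undup; apply/flattenP.
  exists (msupp (P F)) => //; apply: map_f.
  by rewrite mem_filter hF eqxx mem_enum.
have Ldeg m : m \in L -> \sum_j shift_exp N m j = t.
  rewrite mem_undup => /flattenP [s /mapP [F]].
  by rewrite mem_filter => /andP [/eqP hF _] -> /(Pdeg _ _ hF) [].
pose Q F : S := \sum_(m <- L) W m F *: 'X_[m].
have QE F m : (Q F)@_m = if m \in L then W m F else 0.
  rewrite /Q raddf_sum /=; case: ifPn => hm.
    rewrite (bigD1_seq m) ?undup_uniq //= mcoeffZ mcoeffX eqxx mulr1 big1 ?addr0 //.
    by move=> m' /negbTE h; rewrite mcoeffZ mcoeffX h mulr0.
  rewrite big_seq big1 // => m' hm'; rewrite mcoeffZ mcoeffX.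
  case: eqP => [e|_]; last by rewrite mulr0.
  by rewrite -e hm' in hm.
have Qdeg F m : #|F|.+1 = i -> m \in msupp (Q F) ->
    neg_in (shift_exp N m) F /\ \sum_j shift_exp N m j = t.
  move=> hF; rewrite mcoeff_msupp QE; case: ifP => [hm|_]; last by rewrite eqxx.
  move=> nz; have sm := Ldeg _ hm; split=> //; have [h _] := hW m sm.
  by apply: NNPP => hneg; rewrite (h F) ?eqxx in nz.
exists (fun F => mkfrac setT (Q F) N) => F hF.
  by apply/loc_deg_frac => m; apply: Qdeg.
rewrite hP ?hF // (@cech_d_frac _ Q N) // -mkfracB.
apply/loc_ideal_frac => m; rewrite mcoeff_msupp mcoeffB mcoeff_d => nz.
apply: NNPP => hloc; move/eqP: nz; apply.
have hQ : scal_d (fun G => (Q G)@_m) F = if m \in L then scal_d (W m) F else 0.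
  case: ifP => hm; last by apply: big1 => j _; rewrite QE hm mulr0.
  by apply: eq_scal_d => j _; rewrite QE hm.
rewrite hQ; case: ifPn => [hm|hm]; last first.
  rewrite subr0; apply/eqP; apply: contraNT hm; rewrite -mcoeff_msupp.
  exact: LE hF.
have [h1 h2] := hW m (Ldeg _ hm).
have [hneg|hneg] := classic (neg_in (shift_exp N m) F).
  by rewrite h2 // subrr.
rewrite (@scal_d_neg _ (shift_exp N m)) //; last first.
  by move=> G hG; apply: h1; rewrite hG.
rewrite subr0; apply/eqP; apply: contra_notT hneg.
by rewrite -mcoeff_msupp => /(Pdeg _ _ hF) [].
Qed.

End Degreewise.

(** * Monomials in the powers of the Stanley-Reisner ideal of a graph *)

Section Powers.
Variables (r : nat) (e : rel 'I_r).
Implicit Types (a : 'I_r -> int) (F : {set 'I_r}) (m b : 'X_{1..r}).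

Fixpoint in_pow n m : Prop :=
  if n is n'.+1 then
    exists F m', [/\ ~~ graph_face e F, in_pow n' m' & m = (indic_mnm F + m')%MM]
  else True.

Lemma in_powD n m m' : in_pow n m -> in_pow n (m' + m)%MM.
Proof.
elim: n m m' => //= n IH m m' [F [m0 [hF h0 ->]]].
by exists F, (m' + m0)%MM; split=> //; [exact: IH | rewrite !addmA (addmC m')].
Qed.

Lemma graph_faceS F F' : F \subset F' -> graph_face e F' -> graph_face e F.
Proof.
move=> sF; rewrite /graph_face => /orP [h|/existsP [i /existsP [j /andP [eij /eqP E]]]].
  by rewrite (leq_trans (subset_leq_card sF) h).
have [h|h] := leqP #|F| 1 => //=.
apply/existsP; exists i; apply/existsP; exists j; rewrite eij -E /=.
rewrite eqEcard sF E (leq_trans _ h) // cards2; by case: (i != j).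
Qed.

Lemma graph_face_card F : graph_face e F -> (#|F| <= 2)%N.
Proof.
case/orP=> [h|/existsP [i /existsP [j /andP [_ /eqP ->]]]]; first exact: leqW.
by rewrite cards2; case: (i != j).
Qed.

(** Each of the [n] nonfaces dividing the monomial has a vertex outside [F0]. *)
Lemma in_pow_weight n m F0 : graph_face e F0 -> in_pow n m ->
  (n <= \sum_(l | l \notin F0) m l)%N.
Proof.
move=> hF0; elim: n m => //= n IH m [F [m' [hF /IH h ->]]].
have [l lF lF0] : exists2 l, l \in F & l \notin F0.
  by apply/subsetPn; apply: contra hF => /graph_faceS; apply.
under eq_bigr do rewrite mnmDE mnmE.
by rewrite big_split /= (bigD1 l) //= lF; lia.
Qed.

Section Ideal.
Variable K : fieldType.
Notation S := {mpoly K[r]}.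

Lemma ideal_gen_sum (A : S -> Prop) (I : eqType) (s : seq I) (f : I -> S) :
  (forall i, i \in s -> ideal_gen A (f i)) -> ideal_gen A (\sum_(i <- s) f i).
Proof.
elim: s => [|i s IH] h; first by exists [::]; rewrite ?big_nil.
have [s1 h1 e1] := h i (mem_head _ _).
have [|s2 h2 e2] := IH; first by move=> j js; apply: h; rewrite inE js orbT.
exists (s1 ++ s2); last by rewrite big_cons big_cat e1 e2.
by move=> c; rewrite mem_cat => /orP [/h1|/h2].
Qed.

Lemma ideal_genM (A : S -> Prop) c q : A q -> ideal_gen A (c * q).
Proof. by move=> h; exists [:: (c, q)]; rewrite ?big_seq1 // => x /[!inE] /eqP ->. Qed.

Lemma msuppMP (p q : S) m : m \in msupp (p * q) ->
  exists m1 m2, [/\ m1 \in msupp p, m2 \in msupp q & m = (m1 + m2)%MM].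
Proof. by move/msuppM_le/allpairsP => [[m1 m2] /= [h1 h2 h3]]; exists m1, m2. Qed.

Lemma ideal_gen_supp (A : S -> Prop) (M : 'X_{1..r} -> Prop) p :
  (forall m m', M m -> M (m' + m)%MM) ->
  (forall q, A q -> forall m, m \in msupp q -> M m) ->
  ideal_gen A p -> forall m, m \in msupp p -> M m.
Proof.
move=> MD hA [s hs ->] m /msupp_sum_le /flattenP [t /mapP [c]].
rewrite filter_predT => cs -> /msuppMP [m1 [m2 [_ /(hA _ (hs _ cs)) h ->]]].
exact: MD.
Qed.

Lemma monomial_in_pow n m : in_pow n m ->
  exists (g : nat -> S) (c : S),
    (forall i, sr_ideal e (g i)) /\ 'X_[m] = c * \prod_(i < n) g i.
Proof.
elim: n m => [|n IH] m /=.
  move=> _; exists (fun=> 0), 'X_[m]; rewrite big_ord0 mulr1; split=> // _.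
  by exists [::]; rewrite ?big_nil.
case=> F [m' [hF /IH [g [c [hg hc]]] ->]].
exists (fun i => if i is j.+1 then g j else xmon K F), c; split.
  case=> [|i] //; rewrite -[xmon _ _]mul1r; apply: ideal_genM.
  by exists F.
rewrite big_ord_recl mulrCA -hc mpolyXD; congr (_ * _).
by rewrite -[RHS]expr1 xmonXE mulm1n.
Qed.

(** In one direction the supports are followed through sums and products; in the
    other each monomial of [p] is a multiple of a product of [n] generators. *)
Lemma ideal_powP n (p : S) : ideal_pow (sr_ideal e (K := K)) n p <->
  forall m, m \in msupp p -> in_pow n m.
Proof.
split.
  apply: ideal_gen_supp; first exact: in_powD.
  move=> _ [f hf ->]; elim: n f hf => [|n IH] f hf m //.
  rewrite big_ord_recl => /msuppMP [m1 [m2 [h1 h2 ->]]].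
  have sr_supp := @ideal_gen_supp _ (fun m => exists F m',
    ~~ graph_face e F /\ m = (indic_mnm F + m')%MM) _ _ _ (hf ord0) m1 h1.
  case: sr_supp => [m0 m' [F [m'' [hF ->]]]|q [F hF ->] m0|F [m' [hF ->]]].
  - by exists F, (m' + m'')%MM; rewrite !addmA (addmC m').
  - rewrite -[xmon _ _]expr1 xmonXE mulm1n msuppX inE => /eqP ->.
    by exists F, 0%MM; rewrite addm0.
  exists F, (m' + m2)%MM; split=> //; last by rewrite addmA.
  by apply: in_powD; apply: IH h2 => i; apply: hf.
move=> h; rewrite (mpolyE p); apply: ideal_gen_sum => m /h.
case/monomial_in_pow=> g [c [hg ->]]; rewrite scalerAl; apply: ideal_genM.
by exists (fun i => g i).
Qed.

End Ideal.

Definition outside F : 'I_r -> nat := fun l => l \notin F.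
(** Weight for nonfaces through [v]: a non-neighbour of [v] forms one with [v]
    alone, whereas two distinct neighbours are needed to complete [v] to a
    nonface. *)
Definition star_wt v : 'I_r -> nat :=
  fun l => if l == v then 0%N else if e v l then 1%N else 2.
Definition weight a (f : 'I_r -> nat) : int := \sum_l a l * (f l)%:Z.
Definition mnm_weight (f : 'I_r -> nat) b : nat := (\sum_l f l * b l)%N.

Lemma mnm_weight1D f l b : mnm_weight f (U_(l) + b)%MM = (f l + mnm_weight f b)%N.
Proof.
rewrite /mnm_weight; under eq_bigr do rewrite mnmDE mulnDr.
rewrite big_split /=; congr (_ + _)%N; rewrite (bigD1 l) //= mnm1E eqxx muln1.
by rewrite big1 ?addn0 // => i /negbTE h; rewrite mnm1E eq_sym h muln0.
Qed.

Lemma mnm_weight_gt0 f b : (0 < mnm_weight f b)%N -> exists2 l, (0 < f l)%N & (0 < b l)%N.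
Proof.
rewrite lt0n sum_nat_eq0 negb_forall => /existsP [l].
by rewrite /= muln_eq0 negb_or -!lt0n => /andP [h1 h2]; exists l.
Qed.

Lemma mnm_split b l : (0 < b l)%N -> exists b', b = (U_(l) + b')%MM.
Proof.
move=> h; exists (b - U_(l))%MM; rewrite addmC submK //.
by apply/mnm_lepP => i; rewrite mnm1E; case: eqP => [<-|].
Qed.

Lemma in_pow_off n F b : (forall l, l \notin F -> ~~ graph_face e (l |: F)) ->
  (n <= mnm_weight (outside F) b)%N ->
  exists2 m, in_pow n m & forall l, l \notin F -> (m l <= b l)%N.
Proof.
move=> hF; elim: n b => [|n IH] b h.
  by exists 0%MM => // l _; rewrite mnm0E.
have [l hl /mnm_split [b' eb]] := mnm_weight_gt0 (leq_ltn_trans (leq0n _) h).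
have lF : l \notin F by move: hl; rewrite /outside; case: (l \notin F).
subst b; move: h; rewrite mnm_weight1D /outside lF => /IH [m hm lem].
exists (indic_mnm (l |: F) + m)%MM; first by exists (l |: F), m; split=> //; apply: hF.
move=> j jF; rewrite !mnmDE mnmE mnm1E in_setU1 (negbTE jF) orbF eq_sym.
by rewrite leq_add2l lem.
Qed.

Lemma mnm_split2 b j k : j != k -> (0 < b j)%N -> (0 < b k)%N ->
  exists b', b = (U_(j) + (U_(k) + b'))%MM.
Proof.
move=> jk /mnm_split [b' ->]; rewrite mnmDE mnm1E (negbTE jk) => /mnm_split [b'' ->].
by exists b''.
Qed.

Hypothesis e_irr : irreflexive e.
Hypothesis e_sym : ssrbool.symmetric e.

Lemma graph_face2 i j : i != j -> graph_face e [set i; j] = e i j.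
Proof.
move=> ij; rewrite /graph_face cards2 ij /=; apply/existsP/idP => [|eij]; last first.
  by exists i; apply/existsP; exists j; rewrite eij eqxx.
case=> x /existsP [y /andP [exy /eqP E]].
have := set21 x y; have := set22 x y; rewrite -E !inE.
move=> /orP [] /eqP ey /orP [] /eqP ex; move: exy; rewrite ex ey ?e_irr //.
by rewrite e_sym.
Qed.

(** If [x_v] is inverted, [x^b] lies in the [n]-th power when it is divisible,
    up to powers of [x_v], by a product of [n] nonfaces through [v].  The
    induction uses first the non-neighbours, one at a time, and then takes the two neighbours of largest
    exponent, a greedy matching in which the condition on every neighbour is
    kept. *)
Lemma in_pow_star n v b : (2 * n <= mnm_weight (star_wt v) b)%N ->
  (forall k, e v k -> (n <= mnm_weight (outside [set v; k]) b)%N) ->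
  exists2 m, in_pow n m & forall l, l != v -> (m l <= b l)%N.
Proof.
elim: n b => [|n IH] b hW hk.
  by exists 0%MM => // l _; rewrite mnm0E.
have wv_out l : l != v -> ~~ e v l -> star_wt v l = 2.
  by rewrite /star_wt => /negbTE -> /negbTE ->.
have wv_in l : e v l -> star_wt v l = 1%N.
  by move=> evl; rewrite /star_wt evl; case: eqP evl => // ->; rewrite e_irr.
have offE k l : outside [set v; k] l = (l != v) && (l != k) :> nat.
  by rewrite /outside !inE negb_or.
have [/existsP [l /and3P [lv evl bl]]|/existsPn hout] :=
    boolP [exists l, [&& l != v, ~~ e v l & (0 < b l)%N]].
  have [b' eb] := mnm_split bl; subst b.
  have [||m hm lem] := IH b'.
  - by move: hW; rewrite mnm_weight1D wv_out //; lia.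
  - move=> k evk; have := hk k evk; rewrite mnm_weight1D offE lv.
    by case: eqP => [el|_]; [rewrite el evk in evl | rewrite /= add1n ltnS].
  exists (indic_mnm [set v; l] + m)%MM.
    by exists [set v; l], m; split=> //; rewrite graph_face2 // eq_sym.
  move=> j jv; rewrite !mnmDE mnmE mnm1E !inE (negbTE jv) eq_sym /=.
  by rewrite leq_add2l lem.
have bN l : l != v -> (0 < b l)%N -> e v l.
  by move=> lv bl; apply: contraT => evl; have := hout l; rewrite lv evl bl.
have hW' : mnm_weight (star_wt v) b = (\sum_(l | l != v) b l)%N.
  rewrite [RHS]big_mkcond; apply: eq_bigr => l _; case: (eqVneq l v) => [->|lv] /=.
    by rewrite /star_wt eqxx mul0n.
  case: (posnP (b l)) => [->|/(bN _ lv) evl]; first by rewrite muln0.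
  by rewrite wv_in // mul1n.
have offS k : e v k -> (mnm_weight (outside [set v; k]) b + b k = mnm_weight (star_wt v) b)%N.
  move=> evk; have kv : k != v by apply: contraTneq evk => ->; rewrite e_irr.
  rewrite hW' (bigD1 k) //= addnC; congr (_ + _)%N.
  rewrite [RHS]big_mkcond; apply: eq_bigr => l _; rewrite offE.
  by case: (_ && _); rewrite ?mul0n ?mul1n.
have [l1 hl1 bl1] : exists2 l, (0 < star_wt v l)%N & (0 < b l)%N.
  by apply: mnm_weight_gt0; apply: leq_trans hW.
have evl1 : e v l1 by apply: bN => //; apply: contraTneq hl1 => ->; rewrite /star_wt eqxx.
pose j := [arg max_(l > l1 | e v l) b l].
have [evj jmax] : e v j /\ forall l, e v l -> (b l <= b j)%N.
  by rewrite /j; case: arg_maxnP.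
have [l2 hl2 bl2] : exists2 l, (0 < outside [set v; j] l)%N & (0 < b l)%N.
  by apply: mnm_weight_gt0; apply: leq_trans (hk j evj).
move: hl2; rewrite offE lt0b => /andP [l2v l2j].
have evl2 : e v l2 by apply: bN.
pose k := [arg max_(l > l2 | e v l && (l != j)) b l].
have [evk kj kmax] : [/\ e v k, k != j & forall l, e v l -> l != j -> (b l <= b k)%N].
  rewrite /k; case: arg_maxnP => [|l /andP [h1 h2] h3]; first by rewrite evl2.
  by split=> // l' h4 h5; apply: h3; rewrite h4.
have bj : (0 < b j)%N by apply: leq_trans (jmax _ evl1).
have bk : (0 < b k)%N by apply: leq_trans (kmax _ evl2 l2j).
have [jv kv] : j != v /\ k != v.
  by split; [apply: contraTneq evj | apply: contraTneq evk] => ->; rewrite e_irr.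
have [|b' eb] := mnm_split2 _ bj bk; first by rewrite eq_sym.
have [||m hm lem] := IH b'.
- by move: hW; rewrite eb !mnm_weight1D !wv_in //; lia.
- move=> l evl; have := hk l evl; rewrite eb !mnm_weight1D !offE jv kv /=.
  case: (eqVneq j l) => [el|jl]; first by rewrite -el kj /=; lia.
  case: (eqVneq k l) => [el|kl]; first by rewrite /=; lia.
  rewrite /= => _.
  have e1 : (mnm_weight (outside [set v; l]) b = 2 + mnm_weight (outside [set v; l]) b')%N.
    by rewrite eb !mnm_weight1D !offE jv kv jl kl.
  have h1 := jmax l evl; have h2 := kmax l evl; rewrite eq_sym jl in h2.
  have h6 : (b j + b k <= mnm_weight (outside [set v; l]) b)%N.
    rewrite /mnm_weight (bigD1 j) //= (bigD1 k) //= !offE jv kv jl kl /=; lia.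
  by move: (h2 isT) (offS l evl) hW; lia.
exists (indic_mnm [set v; j; k] + m)%MM.
  exists [set v; j; k], m; split=> //; apply/negP => /graph_face_card.
  by rewrite setUC cardsU1 !inE negb_or kv kj cards2 eq_sym jv.
move=> l lv; rewrite eb !mnmDE mnmE !mnm1E !inE (negbTE lv) /= addnA.
rewrite (eq_sym j) (eq_sym k); apply: leq_add; last exact: lem.
by case: (eqVneq l j) => [->|_] //=; case: (_ == _).
Qed.

Variable n : nat.

(** The coordinates in [F] may be made as large as desired, hence only those
    outside [F] have to dominate the exponent of a monomial of the power. *)
Lemma in_locI a F m : neg_in a F -> in_pow n m ->
  (forall l, l \notin F -> (m l)%:Z <= a l) -> in_loc (in_pow n) a F.
Proof.
move=> hneg hm le.
pose k := (\sum_l (`|a l| + m l))%N.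
have kP l : (`|a l| + m l <= k)%N by rewrite /k (bigD1 l) //= leq_addr.
pose m' : 'X_{1..r} := [multinom `|(a l + (k * (l \in F))%:Z)%R|%N | l < r].
have m'E l : (m' l)%:Z = a l + (k * (l \in F))%:Z.
  rewrite mnmE; have := kP l; have := hneg l; case: (l \in F) => /=; first by lia.
  by move=> /(_ isT); lia.
exists k, m'; split=> //.
have -> : m' = (m' - m + m)%MM.
  rewrite submK //; apply/mnm_lepP => l; have := m'E l; have := kP l.
  by have := le l; case: (l \in F) => /= [_|/(_ isT)]; lia.
exact: in_powD.
Qed.

Lemma deg_face_graph a F : deg_face (in_pow n) a F -> graph_face e F.
Proof.
case=> hneg hloc; apply: contra_notT hloc => hF.
apply: (@in_locI _ _ (indic_mnm F *+ n)%MM) => //.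
  by elim: n => // k IH; exists F, (indic_mnm F *+ k)%MM; rewrite mulmS.
by move=> l lF; rewrite mulmnE mnmE (negbTE lF); apply: hneg.
Qed.

Lemma deg_faceI a F F0 : F \subset F0 -> graph_face e F0 -> neg_in a F ->
  weight a (outside F0) < n%:Z -> deg_face (in_pow n) a F.
Proof.
move=> /subsetP sF hF0 hneg hw; split=> // -[k [m [hm hma]]].
have h := in_pow_weight hF0 hm.
suff e1 : weight a (outside F0) = (\sum_(l | l \notin F0) m l)%N by move: hw; rewrite e1; lia.
rewrite (big_morph Posz PoszD (erefl _)) [RHS]big_mkcond /=.
apply: eq_bigr => l _; rewrite /outside; case: ifP => [lF0|_]; last by rewrite mulr0.
rewrite mulr1 hma; suff /negbTE -> : l \notin F by rewrite muln0 addr0.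
by apply: contra lF0; apply: sF.
Qed.

Definition mabs a : 'X_{1..r} := [multinom `|a l|%N | l < r].

Lemma weight_mabs a f F : neg_in a F -> (forall l, l \in F -> f l = 0%N) ->
  weight a f = (mnm_weight f (mabs a))%:Z.
Proof.
move=> hneg hf; rewrite (big_morph Posz PoszD (erefl _)).
apply: eq_bigr => l _; rewrite mnmE; case: (boolP (l \in F)) => [/hf ->|/hneg ?].
  by rewrite mulr0 mul0n.
by rewrite PoszM gez0_abs // mulrC.
Qed.

Lemma deg_face_edge a i j : e i j -> deg_face (in_pow n) a [set i; j] ->
  weight a (outside [set i; j]) < n%:Z.
Proof.
move=> eij [hneg hloc]; rewrite (weight_mabs hneg); last by move=> l; rewrite /outside => ->.
have ij : i != j by apply: contraTneq eij => ->; rewrite e_irr.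
rewrite ltz_nat ltnNge; apply: contra_notN hloc => h.
have [|m hm le] := in_pow_off _ h.
  move=> l hl; apply/negP => /graph_face_card.
  by rewrite cardsU1 hl cards2 ij.
apply: (in_locI hneg hm) => l hl; have := le l hl; have := hneg l hl.
by rewrite mnmE; lia.
Qed.

(** The contrapositive of [in_pow_star], whose two hypotheses are the failure of
    the star inequality and the absence of all the edges at [v]. *)
Lemma deg_face_vertex a v : deg_face (in_pow n) a [set v] ->
  (exists2 k, e v k & weight a (outside [set v; k]) < n%:Z) \/
  weight a (star_wt v) < 2 * n%:Z.
Proof.
move=> [hneg hloc]; apply: NNPP => /not_or_and [h1 h2]; apply: hloc.
have off0 k l : l \in [set v] -> outside [set v; k] l = 0%N.
  by move=> /set1P ->; rewrite /outside !inE eqxx.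
have [||m hm le] := @in_pow_star n v (mabs a).
- have e1 : weight a (star_wt v) = (mnm_weight (star_wt v) (mabs a))%:Z.
    by apply: weight_mabs hneg _ => l /set1P ->; rewrite /star_wt eqxx.
  by move: h2; rewrite e1; lia.
- move=> k evk; have := weight_mabs hneg (off0 k) => e1.
  rewrite leqNgt; apply/negP => h; apply: h1; exists k => //.
  by rewrite e1 ltz_nat.
apply: (in_locI hneg hm) => l; rewrite inE => hl; have := le l hl; have := hneg l.
by rewrite inE mnmE => /(_ hl); lia.
Qed.

End Powers.

(** * First cohomology of graphs *)

(** A forest has no first cohomology.  Removing an edge [uv] disconnects [v] from
    [u], since a path between them would close up to a cycle; a potential of the
    remaining graph can then be shifted on the component of [v]. *)
Lemma forest_potential (T : finType) (V : zmodType) (g : rel T) (z : T -> T -> V) :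
  ssrbool.symmetric g ->
  (forall c, uniq c -> cycle g c -> (size c < 3)%N) ->
  (forall x y, g x y -> z y x = - z x y) -> irreflexive g ->
  exists w, forall x y, g x y -> z x y = w y - w x.
Proof.
move: {2}(#|[set p | g p.1 p.2]|) (leqnn #|[set p | g p.1 p.2]|) => N.
elim: N g => [|N IH] g hN g_sym acyc z_anti g_irr.
  exists (fun=> 0) => x y gxy; move: hN; rewrite leqn0 cards_eq0 => /eqP.
  by move/setP/(_ (x, y)); rewrite !inE /= gxy.
have [/existsP [u /existsP [v guv]]|hno] := boolP [exists u, exists v, g u v]; last first.
  exists (fun=> 0) => x y gxy; case/negP: hno.
  by apply/existsP; exists x; apply/existsP; exists y.
pose h x y := g x y && ((x, y) != (u, v)) && ((x, y) != (v, u)).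
have uv : u != v by apply: contraTneq guv => ->; rewrite g_irr.
have sub_hg : subrel h g by move=> x y /andP [/andP [-> _] _].
have h_sym : ssrbool.symmetric h.
  move=> x y; rewrite /h g_sym -!andbA; congr (_ && _).
  by rewrite !xpair_eqE [LHS]andbC ![(y == _) && _]andbC.
have [|||||w' hw'] := IH h.
- rewrite -ltnS; apply: leq_trans hN; apply: proper_card; apply/properP; split.
    by apply/subsetP => -[x y]; rewrite !inE; apply: sub_hg.
  by exists (u, v); rewrite !inE //= /h eqxx andbF.
- exact: h_sym.
- by move=> c uc /(sub_cycle sub_hg); apply: acyc.
- by move=> x y /sub_hg; apply: z_anti.
- by move=> x; rewrite /h g_irr.
have nconn : ~~ connect h v u.
  apply/negP => /connectP [p0 /shortenP [p hp up _] elast].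
  have : (size (v :: p) < 3)%N.
    apply: acyc => //=; rewrite rcons_path -elast guv andbT.
    exact: sub_path hp.
  case: p hp up elast => [|x [|y p]] //=.
    by move=> _ _ eu; rewrite eu eqxx in uv.
  by rewrite andbT => hvx _ eu; rewrite -eu /h eqxx andbF in hvx.
pose d := z u v - (w' v - w' u).
exists (fun x => w' x + (if connect h v x then d else 0)) => x y gxy.
have hd : z u v = w' v + d - w' u by rewrite /d addrAC addrC subrK.
have [/eqP [-> ->]|n1] := boolP ((x, y) == (u, v)).
  by rewrite connect0 (negbTE nconn) addr0.
have [/eqP [-> ->]|n2] := boolP ((x, y) == (v, u)).
  by rewrite connect0 (negbTE nconn) addr0 z_anti // hd opprB.
have hxy : h x y by rewrite /h gxy n1 n2.
have -> : connect h v x = connect h v y.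
  exact: (same_connect_r (sym_connect_sym h_sym) (connect1 hxy)).
by rewrite (hw' _ _ hxy) opprD addrACA subrr addr0.
Qed.

(** * The degree complexes with nonzero cohomology *)

Section Scal.
Variables (K : fieldType) (r : nat).
Implicit Types (z w : {set 'I_r} -> K) (F : {set 'I_r}).

Lemma scal_d1 z v : scal_d z [set v] = z set0.
Proof.
rewrite /scal_d big_set1 setDv (_ : [set l in _ | _] = set0) ?cards0 ?mul1r //.
by apply/setP => l; rewrite !inE; case: eqP => // ->; rewrite ltnn.
Qed.

Lemma scal_d2 z i j : i != j ->
  scal_d z [set i; j] = (-1) ^+ (j < i)%N * (z [set j] - z [set i]).
Proof.
move=> ij; rewrite /scal_d big_setU1 ?inE // big_set1.
have c (x y : 'I_r) : x != y -> #|[set l in [set x; y] | (l < x)%N]| = (y < x)%N :> nat.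
  move=> xy; case: ltnP => yx.
    rewrite (_ : [set l in _ | _] = [set y]) ?cards1 //; apply/setP => l.
    rewrite !inE; case: (eqVneq l y) => [->|_]; first by rewrite orbT yx.
    by rewrite orbF; case: eqP => // ->; rewrite ltnn.
  rewrite (_ : [set l in _ | _] = set0) ?cards0 //; apply/setP => l.
  rewrite !inE; apply/negP => /andP [/orP [] /eqP -> ]; first by rewrite ltnn.
  by rewrite ltnNge yx.
have cj : #|[set l in [set i; j] | (l < j)%N]| = (i < j)%N :> nat.
  by rewrite [[set i; j]]setUC c 1?eq_sym.
rewrite c // cj.
have -> : [set i; j] :\ i = [set j].
  by apply/setP => l; rewrite !inE; case: (eqVneq l i) => //= ->; rewrite (negbTE ij).
have -> : [set i; j] :\ j = [set i].
  apply/setP => l; rewrite !inE; case: (eqVneq l j) => [->|] //=.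
    by rewrite eq_sym (negbTE ij).
  by rewrite orbF.
have : (i < j)%N != (j < i)%N.
  by move: ij; rewrite -val_eqE /=; case: ltngtP.
by case: (i < j)%N; case: (j < i)%N => //= _; rewrite ?expr0 ?expr1; ring.
Qed.

End Scal.

Section Bounds.
Variables (K : fieldType) (r : nat) (e : rel 'I_r) (n : nat).
Hypotheses (e_irr : irreflexive e) (e_sym : ssrbool.symmetric e).
Implicit Types (a : 'I_r -> int) (F : {set 'I_r}) (z w : {set 'I_r} -> K).
Local Notation dface := (deg_face (in_pow e n)).
Local Notation H a i := (cohom_neq0 K (in_pow e n) a i).

(** Boolean form of the edges of the degree complex of [a], see
    [deg_edge_dface] and [dface_deg_edge]. *)
Definition deg_edge a : rel 'I_r := fun x y => e x y && (weight a (outside [set x; y]) < n%:Z).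

Lemma adj_neq x y : e x y -> x != y.
Proof. by apply: contraTneq => ->; rewrite e_irr. Qed.

Lemma deg_edge_sym a : ssrbool.symmetric (deg_edge a).
Proof. by move=> x y; rewrite /deg_edge e_sym setUC. Qed.

Lemma deg_edge_dface a x y : deg_edge a x y -> neg_in a [set x; y] -> dface a [set x; y].
Proof.
move=> /andP [exy h] hneg; apply: (deg_faceI (subxx _)) => //.
by rewrite graph_face2 // adj_neq.
Qed.

Lemma dface_deg_edge a x y : x != y -> dface a [set x; y] -> deg_edge a x y.
Proof.
move=> xy h; have exy : e x y by rewrite -graph_face2 //; apply: deg_face_graph h.
by rewrite /deg_edge exy; apply: deg_face_edge h.
Qed.

Lemma dface_card a F i : (3 <= i)%N -> #|F| = i -> ~ dface a F.
Proof. by move=> hi hF /deg_face_graph /graph_face_card; lia. Qed.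

Lemma H_le2 a i : H a i -> (i <= 2)%N.
Proof.
case=> z [_ _ hnb]; rewrite leqNgt; apply/negP => hi; apply: hnb.
by exists (fun=> 0) => // F hF /(dface_card hi hF).
Qed.

Lemma scal_d0 F : scal_d (fun=> 0 : K) F = 0.
Proof. by apply: big1 => j _; rewrite mulr0. Qed.

Lemma neg_in_mem a F l : neg_in a F -> a l < 0 -> l \in F.
Proof. by move=> h al; apply: contraT => /h; rewrite leNgt al. Qed.

Lemma set2_other F v : #|F| = 2 -> v \in F -> exists2 k, k != v & F = [set v; k].
Proof.
move=> hF vF; move: hF; rewrite (cardsD1 v) vF => -[] /eqP /cards1P [k hk].
exists k; last by rewrite -(setD1K vF) hk.
by have := set11 k; rewrite -hk !inE => /andP [].
Qed.

(** A nonzero [H^1] means that the vertex cochains constant along edges are not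
    all constant or, when [a] has a negative coordinate [v] (so that [set0]
    carries no cochain), that [v] is isolated in the degree complex. *)
Lemma H1_cases a : H a 1 ->
  (exists v : 'I_r, [/\ a v < 0, (forall l : 'I_r, l != v -> 0 <= a l), dface a [set v]
     & forall k : 'I_r, e v k -> ~~ deg_edge a v k]) \/
  ((forall l, 0 <= a l) /\ exists (z : 'I_r -> K) (i j : 'I_r),
     [/\ dface a [set i], dface a [set j], z i != z j
       & forall x y : 'I_r, deg_edge a x y -> z x = z y]).
Proof.
case=> z [zneg zc znb].
have sing F : #|F| = 1%N -> exists x, F = [set x].
  by move/eqP/cards1P.
have [[v av]|hpos] := classic (exists v, a v < 0); last first.
  right; have apos l : 0 <= a l by rewrite leNgt; apply/negP => h; apply: hpos; exists l.
  split=> //; apply: NNPP => hno; apply: znb.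
  have zgam x y : deg_edge a x y -> z [set x] = z [set y].
    move=> g; have xy : x != y by apply: adj_neq; case/andP: g.
    have : scal_d z [set x; y] = 0.
      by apply: zc; [rewrite cards2 xy|apply: deg_edge_dface].
    rewrite scal_d2 // => /eqP; rewrite mulf_eq0 signr_eq0 /= subr_eq0.
    by move/eqP.
  have hall i j : dface a [set i] -> dface a [set j] -> z [set i] = z [set j].
    move=> hi hj; apply/eqP; apply: contra_notT hno => zij.
    by exists (fun x => z [set x]), i, j.
  have [[i hi]|hnone] := classic (exists i, dface a [set i]).
    exists (fun=> z [set i]); first by move=> F _ h; case: h => l _.
    by move=> _ /sing [x ->] hx; rewrite scal_d1; apply: hall.
  exists (fun=> 0) => // F /sing [x ->] hx; case: hnone; by exists x.
left; apply: NNPP => hno; apply: znb; exists (fun=> 0) => // F /sing [x ->] hx.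
have ex : v = x by have := neg_in_mem hx.1 av; rewrite inE => /eqP.
subst x; rewrite scal_d0; apply: NNPP => nz; apply: hno; exists v; split=> //.
  by move=> l lv; apply: hx.1; rewrite inE.
move=> k evk; apply/negP => g; apply: nz; have vk := adj_neq evk.
have : scal_d z [set v; k] = 0.
  apply: zc; first by rewrite cards2 vk.
  by apply: deg_edge_dface => //; apply: neg_inS hx.1; rewrite sub1set set21.
rewrite scal_d2 // => /eqP; rewrite mulf_eq0 signr_eq0 /= subr_eq0 => /eqP <-.
apply: zneg; first by rewrite cards1.
by move=> /neg_in_mem /(_ av); rewrite inE (negbTE vk).
Qed.

(** The three cases correspond to two, one and zero negative coordinates of [a].
    With one, [v], the vertex cochains reduce to a single scalar, which is
    enough to kill a cochain supported on one edge at [v]. *)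
Lemma H2_cases a : H a 2 ->
  [\/ exists i j : 'I_r, [/\ i != j, a i < 0, a j < 0, neg_in a [set i; j] & deg_edge a i j],
      exists v j k : 'I_r, [/\ a v < 0, j != k, (forall l : 'I_r, l != v -> 0 <= a l),
        deg_edge a v j & deg_edge a v k]
    | (forall l, 0 <= a l) /\ exists c : seq 'I_r,
        [/\ uniq c, cycle (deg_edge a) c & (3 <= size c)%N]].
Proof.
case=> z [zneg zc znb]; apply: NNPP => hno; apply: znb.
have [[v av]|hpos] := classic (exists v, a v < 0); last first.
  have apos l : 0 <= a l by rewrite leNgt; apply/negP => h; apply: hpos; exists l.
  pose zz (x y : 'I_r) := (-1) ^+ (y < x)%N * z [set x; y].
  have [|c uc gc|x y gxy|x|w hw] := @forest_potential _ K (deg_edge a) zz.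
  - exact: deg_edge_sym.
  - rewrite ltnNge; apply/negP => hc; apply: hno; apply: Or33; split=> //.
    by exists c.
  - rewrite /zz setUC; have : (x < y)%N != (y < x)%N.
      have /andP [/adj_neq] := gxy; rewrite -val_eqE /=; by case: ltngtP.
    by case: (x < y)%N; case: (y < x)%N => //= _; rewrite ?expr0 ?expr1; ring.
  - by rewrite /deg_edge e_irr.
  exists (fun F => \sum_(x in F) w x); first by move=> F _ h; case: h => l _.
  move=> F hF; have [x xF] : exists x, x \in F by apply/card_gt0P; rewrite hF.
  have [y yx ->] := set2_other hF xF => hd.
  rewrite scal_d2 1?eq_sym // !big_set1 -hw; last by apply: dface_deg_edge; rewrite 1?eq_sym.
  by rewrite /zz mulrA -expr2 sqrr_sign mul1r.
have [[u [uv au]]|hv] := classic (exists u, u != v /\ a u < 0).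
  exists (fun=> 0) => // F hF hd; case: hno; apply: Or31.
  have [y yv eF] := set2_other hF (neg_in_mem hd.1 av).
  have := neg_in_mem hd.1 au; rewrite eF !inE (negbTE uv) /= => /eqP euy; subst y.
  exists v, u; rewrite -eF; split=> //; rewrite 1?eq_sym //; first exact: hd.1.
  by apply: dface_deg_edge; rewrite 1?eq_sym // -eF.
have apos l : l != v -> 0 <= a l.
  by move=> lv; rewrite leNgt; apply/negP => h; apply: hv; exists l.
have dF F : #|F| = 2 -> dface a F -> exists2 k, v != k & F = [set v; k] /\ deg_edge a v k.
  move=> hF hd; have [k kv eF] := set2_other hF (neg_in_mem hd.1 av).
  by exists k; rewrite 1?eq_sym //; split=> //; apply: dface_deg_edge; rewrite 1?eq_sym // -eF.
have [[j gj]|hj] := classic (exists j, deg_edge a v j); last first.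
  exists (fun=> 0) => // F hF /(dF _ hF) [k _ [_ g]]; by case: hj; exists k.
exists (fun F => if F == [set v] then - (-1) ^+ (j < v)%N * z [set v; j] else 0) => F.
  move=> _ hneg; case: eqP => // eF; case: hneg; rewrite eF => l.
  by rewrite inE; apply: apos.
move=> hF /(dF _ hF) [k vk [-> gk]]; have ejk : j = k.
  apply/eqP; apply: contra_notT hno => jk; apply: Or32.
  by exists v, j, k.
subst k; rewrite scal_d2 // eqxx (inj_eq set1_inj) eq_sym (negbTE vk).
by rewrite mulNr opprK add0r mulrA -expr2 sqrr_sign mul1r.
Qed.

(** * Bounds on the total degree *)

Definition total a : int := \sum_l a l.

(** All upper bounds for nonnegative [a] are linear combinations of the
    inequalities expressing membership in the degree complex; it is enough to
    compare the coefficients at each coordinate. *)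
Lemma weight_comb a (s : seq (int * ('I_r -> nat))) (c : int) :
  (forall l, 0 <= a l) ->
  (forall l, c <= \sum_(p <- s) p.1 * (p.2 l)%:Z) ->
  c * total a <= \sum_(p <- s) p.1 * weight a p.2.
Proof.
move=> ha hc; rewrite /total mulr_sumr.
have -> : \sum_(p <- s) p.1 * weight a p.2 =
    \sum_l a l * \sum_(p <- s) p.1 * (p.2 l)%:Z.
  under [RHS]eq_bigr do rewrite mulr_sumr.
  rewrite exchange_big; apply: eq_bigr => p _; rewrite mulr_sumr.
  by apply: eq_bigr => l _; ring.
by apply: ler_sum => l _; rewrite mulrC; apply: ler_wpM2l.
Qed.

Lemma sum_ind (v : 'I_r) : \sum_l (l == v)%:Z = 1.
Proof. by rewrite (bigD1 v) //= eqxx big1 // => l /negbTE ->. Qed.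

Lemma total_add1 a v : \sum_l (a l + (l == v)%:Z) = total a + 1.
Proof. by rewrite big_split /= sum_ind. Qed.

Lemma total_add2 a i j :
  \sum_l (a l + (l == i)%:Z + (l == j)%:Z) = total a + 2.
Proof. by rewrite big_split /= total_add1 sum_ind -addrA. Qed.

Lemma H1_bound_neg a v : a v < 0 -> (forall l, l != v -> 0 <= a l) ->
  dface a [set v] -> (forall k, e v k -> ~~ deg_edge a v k) ->
  total a <= 2 * n%:Z - 2.
Proof.
move=> av apos /(deg_face_vertex e_irr) [//|[k evk hk] hng|hw _].
  by have := hng k evk; rewrite /deg_edge evk hk.
suff : \sum_l (a l + (l == v)%:Z) <= weight a (star_wt e v).
  rewrite total_add1; lia.
apply: ler_sum => l _; rewrite /star_wt; case: (eqVneq l v) => [->|/apos] /=; first by lia.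
by case: (e v l) => /=; lia.
Qed.

Hypothesis n_gt0 : (0 < n)%N.

Lemma H2_bound a : H a 2 -> total a <= 2 * n%:Z - 3 \/
  (forall l, 0 <= a l) /\ exists c : seq 'I_r,
        [/\ uniq c, cycle (deg_edge a) c & (3 <= size c)%N].
Proof.
case/H2_cases => [[i [j [ij ai aj hneg /andP [_ g]]]]|[v [j [k [av jk apos g1 g2]]]]|];
  [left|left|by right].
  suff : \sum_l (a l + (l == i)%:Z + (l == j)%:Z) <= weight a (outside [set i; j]).
    rewrite total_add2; lia.
  apply: ler_sum => l _; have := hneg l; rewrite /outside !inE.
  case: (eqVneq l i) => [->|_] /=; first by rewrite (negbTE ij); lia.
  by case: (eqVneq l j) => [->|_] /=; [lia | move/(_ isT); lia].
case/andP: g1 => /adj_neq vj g1; case/andP: g2 => /adj_neq vk g2.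
suff : \sum_l (a l + (l == v)%:Z) <= weight a (outside [set v; j]) + weight a (outside [set v; k]).
  rewrite total_add1; lia.
rewrite -big_split /=; apply: ler_sum => l _; rewrite /outside !inE.
case: (eqVneq l v) => [->|/apos] /=; first by lia.
case: (eqVneq l j) => [->|_] /=; first by rewrite (negbTE jk); lia.
by case: (eqVneq l k) => /=; lia.
Qed.

Lemma eq_excl (l x y : 'I_r) : x != y -> ~~ ((l == x) && (l == y)).
Proof. by apply: contraNN => /andP [/eqP <- /eqP <-]. Qed.

Lemma cycle3_bound a c : (forall l, 0 <= a l) ->
  uniq c -> cycle (deg_edge a) c -> size c = 3 -> total a <= 3 * n%:Z - 3.
Proof.
move=> apos; case: c => [|x [|y [|z [|t c]]]] //= + + _.
rewrite !inE !andbT negb_or => /andP [/andP [xy xz] yz].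
case/and3P => /andP [_ g1] /andP [_ g2] /andP [_ g3].
have hc l : 1 <= \sum_(p <- [:: (1, outside [set x; y]); (1, outside [set y; z]); (1, outside [set z; x])]) p.1 * (p.2 l)%:Z.
  rewrite !big_cons !big_nil /= /outside !inE.
  have := eq_excl l xy; have := eq_excl l xz; have := eq_excl l yz.
  by do 3 case: (l == _).
have := weight_comb apos hc; rewrite !big_cons !big_nil /=; lia.
Qed.

(** Two disjoint edges of the cycle suffice. *)
Lemma cycle4_bound a c : (forall l, 0 <= a l) ->
  uniq c -> cycle (deg_edge a) c -> (4 <= size c)%N -> total a <= 2 * n%:Z - 2.
Proof.
move=> apos; case: c => [|x [|y [|z [|t c]]]] //= + + _.
rewrite !inE !negb_or -!andbA => /and5P [xy xz xt _ /and4P [yz yt _ _]].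
case/and5P => _ g1 _ _ /and3P [_ g3 _].
have hc l : 1 <= \sum_(p <- [:: (1, outside [set x; y]); (1, outside [set z; t])]) p.1 * (p.2 l)%:Z.
  rewrite !big_cons !big_nil /= /outside !inE.
  have := eq_excl l xz; have := eq_excl l xt; have := eq_excl l yz.
  by have := eq_excl l yt; do 4 case: (l == _).
have := weight_comb apos hc; rewrite !big_cons !big_nil /=; lia.
Qed.

(** Five consecutive edges of the cycle, closing up if its length is 5, meet each
    vertex at most twice, so three times the total is at most [5 (n - 1)]. *)
Lemma cycle5_bound a c : (forall l, 0 <= a l) -> (2 <= n)%N ->
  uniq c -> cycle (deg_edge a) c -> (5 <= size c)%N -> total a <= 2 * n%:Z - 3.
Proof.
move=> apos n2; case: c => [|x1 [|x2 [|x3 [|x4 [|x5 c]]]]] // uc gc _.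
(* the sixth vertex of the cycle, or the first one if there are only five *)
pose y := head x1 c.
have [y2 y3 y4 y5] : [/\ x2 != y, x3 != y, x4 != y & x5 != y].
  rewrite /y; move: uc; case: (c) => [|t d] /=.
    by rewrite !inE !negb_or -!andbA ![x1 == _]eq_sym => /and5P [-> -> -> ->].
  by rewrite !inE !negb_or -!andbA; repeat (case/andP=> ?); split.
have g5 : deg_edge a x5 y.
  by move: gc; rewrite /y /=; case: (c) => [|t d] /= /and5P [_ _ _ _ /andP []].
move: gc => /= /and5P [/andP [_ g1] /andP [_ g2] /andP [_ g3] /andP [_ g4] _].
case/andP: g5 => _ g5.
have [x12 x13 x14 x15 x23] : [/\ x1 != x2, x1 != x3, x1 != x4, x1 != x5 & x2 != x3].
  by move: uc; rewrite /= !inE !negb_or -!andbA; repeat (case/andP=> ?); split.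
have [x24 x25 x34 x35 x45] : [/\ x2 != x4, x2 != x5, x3 != x4, x3 != x5 & x4 != x5].
  by move: uc; rewrite /= !inE !negb_or -!andbA; repeat (case/andP=> ?); split.
have hc l : 3 <= \sum_(p <- [:: (1, outside [set x1; x2]); (1, outside [set x2; x3]);
  (1, outside [set x3; x4]); (1, outside [set x4; x5]); (1, outside [set x5; y])]) p.1 * (p.2 l)%:Z.
  rewrite !big_cons !big_nil /= /outside !inE.
  move: (eq_excl l x12) (eq_excl l x13) (eq_excl l x14) (eq_excl l x15)
    (eq_excl l x23) (eq_excl l x24) (eq_excl l x25) (eq_excl l x34)
    (eq_excl l x35) (eq_excl l x45) (eq_excl l y2) (eq_excl l y3)
    (eq_excl l y4) (eq_excl l y5).
  by do 6 case: (l == _).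
have le := weight_comb apos hc; rewrite !big_cons !big_nil /= in le.
by clear - le n2 g1 g2 g3 g4 g5; lia.
Qed.

Definition triangle_free := forall x y t, e x y -> e y t -> ~~ e x t.
Definition c4_free := forall i j k k', i != j ->
  e i k -> e j k -> e i k' -> e j k' -> k = k'.

(** The inequalities satisfied by a vertex of the degree complex lying on none of
    its edges. *)
Definition bare_vertex a i :=
  weight a (star_wt e i) < 2 * n%:Z /\ forall k, e i k -> n%:Z <= weight a (outside [set i; k]).

Lemma dface_vertexP a i : dface a [set i] -> (exists k, deg_edge a i k) \/ bare_vertex a i.
Proof.
move=> h; have [hk|hk] := classic (exists k, deg_edge a i k); [by left|right].
have h2 k : e i k -> n%:Z <= weight a (outside [set i; k]).
  by move=> eik; rewrite leNgt; apply/negP => g; apply: hk; exists k; rewrite /deg_edge eik.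
split=> //; case: (deg_face_vertex e_irr e_sym h) => // -[k eik].
by rewrite ltNge h2.
Qed.

Definition H1_bounds a := [/\ total a <= 3 * n%:Z - 2, triangle_free -> total a <= 2 * n%:Z - 1
  & triangle_free -> c4_free -> total a <= 2 * n%:Z - 2].

Lemma H1_bounds_uniform a : total a <= 2 * n%:Z - 2 -> H1_bounds a.
Proof. by split; intros; lia. Qed.

Lemma adj_excl v l x : e v x -> ~~ ((l == x) && ~~ e v l).
Proof. by move=> h; apply/negP => /andP [/eqP ->]; rewrite h. Qed.

Lemma nonadj_excl v l x : ~~ e v x -> ~~ ((l == x) && e v l).
Proof. by move=> h; apply/negP => /andP [/eqP ->]; rewrite (negbTE h). Qed.

(** The star inequality at [i] plus the inequality of the edge [jl] minus the
    absence of the edge [ij] has coefficients at least 1. *)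
Lemma bare_edge_adjacent a i j l : (forall l, 0 <= a l) -> bare_vertex a i -> deg_edge a j l ->
  i != j -> i != l -> e i j -> ~~ e i l -> total a <= 2 * n%:Z - 2.
Proof.
move=> apos [hW hk] /andP [ejl g] ij il eij eil.
have hc t : 1 <= \sum_(p <- [:: (1, star_wt e i); (1, outside [set j; l]); (-1, outside [set i; j])]) p.1 * (p.2 t)%:Z.
  rewrite !big_cons !big_nil /= /outside /star_wt !inE.
  move: (eq_excl t ij) (eq_excl t il) (adj_excl t eij) (nonadj_excl t eil) (eq_excl t (adj_neq ejl)).
  by do 3 case: (t == _); case: (e i t).
have := weight_comb apos hc; rewrite !big_cons !big_nil /=; have := hk _ eij; lia.
Qed.

Lemma bare_edge_bounds a i j l : (forall l, 0 <= a l) -> bare_vertex a i -> deg_edge a j l ->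
  i != j -> i != l -> H1_bounds a.
Proof.
move=> apos hw g ij il; have /andP [ejl hg] := g.
case: (boolP (e i j)) => eij; case: (boolP (e i l)) => eil.
- suff h : total a <= 3 * n%:Z - 2.
    by split=> // h3; have := h3 _ _ _ eij ejl; rewrite eil.
  have hc t : 1 <= \sum_(p <- [:: (1, star_wt e i); (1, outside [set j; l])]) p.1 * (p.2 t)%:Z.
    rewrite !big_cons !big_nil /= /outside /star_wt !inE.
    move: (eq_excl t ij) (eq_excl t il).
    by do 3 case: (t == _); case: (e i t).
  have := weight_comb apos hc; rewrite !big_cons !big_nil /=; have := hw.1; lia.
- exact/H1_bounds_uniform/(bare_edge_adjacent apos hw g).
- apply/H1_bounds_uniform/(bare_edge_adjacent apos hw _ il ij eil eij).
  by rewrite deg_edge_sym.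
apply/H1_bounds_uniform.
have hc t : 2 <= \sum_(p <- [:: (1, star_wt e i); (2, outside [set j; l])]) p.1 * (p.2 t)%:Z.
  rewrite !big_cons !big_nil /= /outside /star_wt !inE.
  move: (eq_excl t ij) (eq_excl t il) (nonadj_excl t eij) (nonadj_excl t eil).
  by do 3 case: (t == _); case: (e i t).
have := weight_comb apos hc; rewrite !big_cons !big_nil /=; have := hw.1; lia.
Qed.

(** Without triangles the stars of [i] and [j] overlap only in the edge [ij], whose
    absence from the degree complex can be subtracted twice; in general it is
    subtracted once. *)
Lemma bare_pair_adjacent a i j : (forall l, 0 <= a l) -> bare_vertex a i -> bare_vertex a j ->
  e i j -> H1_bounds a.
Proof.
move=> apos [wi ki] [wj kj] eij; have ij := adj_neq eij; have hk := ki _ eij.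
have eji : e j i by rewrite e_sym.
have h1 : total a <= 3 * n%:Z - 2.
  have hc t : 1 <= \sum_(p <- [:: (1, star_wt e i); (1, star_wt e j); (-1, outside [set i; j])]) p.1 * (p.2 t)%:Z.
    rewrite !big_cons !big_nil /= /outside /star_wt !inE.
    move: (eq_excl t ij) (adj_excl t eij) (adj_excl t eji).
    by do 2 case: (t == _); case: (e i t); case: (e j t).
  have := weight_comb apos hc; rewrite !big_cons !big_nil /=; lia.
suff h2 : triangle_free -> total a <= 2 * n%:Z - 2 by split=> // h3; have := h2 h3; lia.
move=> h3.
have hc t : 1 <= \sum_(p <- [:: (1, star_wt e i); (1, star_wt e j); (-2, outside [set i; j])]) p.1 * (p.2 t)%:Z.
  rewrite !big_cons !big_nil /= /outside /star_wt !inE.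
  have h4 : ~~ (e i t && e j t).
    by apply/negP => /andP [h5]; apply/negP; apply: h3 h5; rewrite e_sym.
  move: (eq_excl t ij) (adj_excl t eij) (adj_excl t eji) h4.
  by do 2 case: (t == _); case: (e i t); case: (e j t).
have := weight_comb apos hc; rewrite !big_cons !big_nil /=; lia.
Qed.

(** The two star inequalities give [2|a| <= 4n - 2].  If the common neighbours of
    [i] and [j] reduce to at most one vertex [k], the absence of the edge [ik]
    improves this by one. *)
Lemma bare_pair_nonadjacent a i j : (forall l, 0 <= a l) -> bare_vertex a i -> bare_vertex a j ->
  i != j -> ~~ e i j -> H1_bounds a.
Proof.
move=> apos [wi ki] [wj kj] ij eij.
have eji : ~~ e j i by rewrite e_sym.
have h1 : total a <= 2 * n%:Z - 1.
  have hc t : 2 <= \sum_(p <- [:: (1, star_wt e i); (1, star_wt e j)]) p.1 * (p.2 t)%:Z.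
    rewrite !big_cons !big_nil /= /star_wt.
    move: (eq_excl t ij) (nonadj_excl t eij) (nonadj_excl t eji).
    by do 2 case: (t == _); case: (e i t); case: (e j t).
  have := weight_comb apos hc; rewrite !big_cons !big_nil /=; lia.
split=> //; first by lia.
move=> _ h4.
have [h0|[k eik hk]] : (forall t, ~~ e i t) \/
    exists2 k, e i k & forall t, e i t -> e j t -> t = k.
  have [/existsP [k /andP [h2 h3]]|/existsPn h2] := boolP [exists k, e i k && e j k].
    by right; exists k => // t h5 h6; apply: h4 ij h5 h6 h2 h3.
  have [/existsP [k h3]|/existsPn h3] := boolP [exists k, e i k]; last by left.
  by right; exists k => // t h5 h6; have := h2 t; rewrite h5 h6.
  (* an isolated vertex has an even star weight, which gains the missing unit *)
  have wi2 : weight a (star_wt e i) = 2 * weight a (outside [set i]).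
    rewrite /weight mulr_sumr; apply: eq_bigr => t _.
    rewrite /star_wt /outside !inE (negbTE (h0 t)).
    by case: (t == i); rewrite /= ?mulr0 ?mulr1 // mulrC.
  move: h1; have hc t : 2 <= \sum_(p <- [:: (1, star_wt e i); (1, star_wt e j)]) p.1 * (p.2 t)%:Z.
    rewrite !big_cons !big_nil /= /star_wt.
    move: (eq_excl t ij) (nonadj_excl t eij) (nonadj_excl t eji).
    by do 2 case: (t == _); case: (e i t); case: (e j t).
  have := weight_comb apos hc; rewrite !big_cons !big_nil /=; lia.
have hki := ki _ eik.
have hc t : 2 <= \sum_(p <- [:: (2, star_wt e i); (1, star_wt e j); (-2, outside [set i; k])])
    p.1 * (p.2 t)%:Z.
  rewrite !big_cons !big_nil /= /outside /star_wt !inE.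
  have h5 : e i t && e j t ==> (t == k).
    by apply/implyP => /andP [h5 h6]; apply/eqP/hk.
  move: (eq_excl t ij) (nonadj_excl t eij) (nonadj_excl t eji) h5 (adj_excl t eik).
  by do 3 case: (t == _); case: (e i t); case: (e j t).
have := weight_comb apos hc; rewrite !big_cons !big_nil /=; lia.
Qed.

Lemma H1_bounded a : H a 1 -> H1_bounds a.
Proof.
case/H1_cases => [[v [av apos hv hng]]|[apos [z [i [j [hi hj zij zg]]]]]].
  exact/H1_bounds_uniform/(H1_bound_neg av apos hv hng).
have ij : i != j by apply: contraNneq zij => ->.
have zn x y : z x != z y -> x != y by apply: contraNneq => ->.
case: (dface_vertexP hi) => [[k gik]|wi]; case: (dface_vertexP hj) => [[l gjl]|wj].
- apply: H1_bounds_uniform.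
  have [il [kj kl]] : i != l /\ k != j /\ k != l.
    have e1 := zg _ _ gik; have e2 := zg _ _ gjl.
    by split; [|split]; apply: zn; rewrite -?e1 -?e2.
  case/andP: gik => _ gik; case/andP: gjl => _ gjl.
  have hc t : 1 <= \sum_(p <- [:: (1, outside [set i; k]); (1, outside [set j; l])]) p.1 * (p.2 t)%:Z.
    rewrite !big_cons !big_nil /= /outside !inE.
    move: (eq_excl t ij) (eq_excl t il) (eq_excl t kj) (eq_excl t kl).
    by do 4 case: (t == _).
  have := weight_comb apos hc; rewrite !big_cons !big_nil /=; lia.
- apply: (bare_edge_bounds apos wj gik); first by rewrite eq_sym.
  by apply: zn; rewrite -(zg _ _ gik) eq_sym.
- by apply: (bare_edge_bounds apos wi gjl) => //; apply: zn; rewrite -(zg _ _ gjl).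
case: (boolP (e i j)) => eij; first exact: bare_pair_adjacent eij.
exact: bare_pair_nonadjacent eij.
Qed.

(** * Nonvanishing *)

Definition pointed_exp (x1 x2 x3 : 'I_r) (c1 c2 c3 : int) : 'I_r -> int :=
  fun l => (l == x1)%:Z * c1 + ((l == x2)%:Z * c2 + (l == x3)%:Z * c3).

Lemma weight_point x (c : int) (f : 'I_r -> nat) :
  \sum_l (l == x)%:Z * c * (f l)%:Z = c * (f x)%:Z.
Proof.
rewrite (bigD1 x) //= eqxx mul1r big1 ?addr0 // => l /negbTE ->.
by rewrite !mul0r.
Qed.

Lemma weight_pointed x1 x2 x3 c1 c2 c3 f : weight (pointed_exp x1 x2 x3 c1 c2 c3) f =
  c1 * (f x1)%:Z + (c2 * (f x2)%:Z + c3 * (f x3)%:Z).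
Proof.
rewrite /weight /pointed_exp; under eq_bigr do rewrite !mulrDl.
by rewrite !big_split /= !weight_point.
Qed.

Lemma total_pointed x1 x2 x3 c1 c2 c3 : total (pointed_exp x1 x2 x3 c1 c2 c3) = c1 + (c2 + c3).
Proof.
have := weight_pointed x1 x2 x3 c1 c2 c3 (fun=> 1%N); rewrite !mulr1 => <-.
by apply: eq_bigr => l _; rewrite mulr1.
Qed.

(** The indicator of the closing edge of a cycle is not a coboundary: a potential
    would be constant along the other edges, hence equal at both ends of that
    one. *)
Lemma H2_of_cycle a c : (forall l, 0 <= a l) -> uniq c -> cycle (deg_edge a) c ->
  (3 <= size c)%N -> H a 2.
Proof.
move=> apos; case: c => [|x [|y [|t q]]] //; set p := t :: q => uc gc _.
have hneg F : neg_in a F by move=> l _.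
pose l := last y p.
have xyp : x \notin y :: p by case/andP: uc.
have yp : y \notin p by case/and3P: uc.
have lp : l \in p by rewrite /l /p /=; apply: mem_last.
have ly : l != y by apply: contraNneq yp => <-.
have lx : l != x by apply: contraNneq xyp => <-; rewrite inE lp orbT.
have yx : y != x by apply: contraNneq xyp => <-; rewrite mem_head.
move: gc; rewrite /cycle rcons_path /= => /andP [/andP [gxy gp] glx].
exists (fun F => (F == [set l; x])%:R); split.
- by move=> F _ /(_ (hneg F)).
- by move=> F hF /(dface_card (leqnn 3) hF).
case=> w _ hw.
have step u v : deg_edge a u v -> [set u; v] != [set l; x] -> w [set u] = w [set v].
  move=> guv ne; have uv : u != v by apply: adj_neq; case/andP: guv.
  have := hw [set u; v]; rewrite cards2 uv (negbTE ne) => /(_ erefl).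
  move=> /(_ (deg_edge_dface guv (hneg _))) /esym /eqP.
  rewrite scal_d2 // mulf_eq0 signr_eq0 subr_eq0 /=.
  by move=> /eqP.
have e1 : w [set x] = w [set y].
  apply: step => //; apply: contraNneq ly => E.
  by have := set21 l x; rewrite -E !inE (negbTE lx).
have walk s u : path (deg_edge a) u s -> x \notin u :: s -> w [set u] = w [set last u s].
  elim: s u => //= v s IH u /andP [guv gs]; rewrite inE negb_or => /andP [xu xvs].
  rewrite (step _ _ guv); first exact: IH.
  have xv : x != v by move: xvs; rewrite inE negb_or => /andP [].
  apply: contraNneq xu => E; have := set22 l x.
  by rewrite -E !inE (negbTE xv) orbF.
have e2 : w [set y] = w [set l] by apply: walk.
have := hw [set l; x]; rewrite cards2 lx => /(_ erefl (deg_edge_dface glx (hneg _))).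
rewrite scal_d2 // e1 e2 subrr mulr0 eqxx => /eqP.
by rewrite oner_eq0.
Qed.

(** With [a] negative at [v] only [v] carries a vertex cochain, so that the
    cochains on the two edges [vj] and [vk] are not both determined by it. *)
Lemma H2_of_path v j k : e v j -> e v k -> j != k ->
  exists2 a, total a = 2 * n%:Z - 3 & H a 2.
Proof.
move=> evj evk jk; have vj := adj_neq evj; have vk := adj_neq evk.
exists (pointed_exp v j k (-1) (n%:Z - 1) (n%:Z - 1)); first by rewrite total_pointed; lia.
set a := pointed_exp _ _ _ _ _ _.
have hneg F : v \in F -> neg_in a F.
  move=> vF l lF; rewrite /a /pointed_exp; case: eqP lF => [->|_ _]; first by rewrite vF.
  by case: (l == j); case: (l == k) => /=; lia.
have dvj : dface a [set v; j].
  apply: deg_edge_dface; last by apply: hneg; rewrite set21.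
  rewrite /deg_edge evj weight_pointed /outside !inE !eqxx orbT /= (eq_sym k) (negbTE vk).
  by rewrite (eq_sym k) (negbTE jk) /=; lia.
have dvk : dface a [set v; k].
  apply: deg_edge_dface; last by apply: hneg; rewrite set21.
  rewrite /deg_edge evk weight_pointed /outside !inE !eqxx orbT /= (eq_sym j) (negbTE vj).
  by rewrite (negbTE jk) /=; lia.
have av : a v < 0.
  by rewrite /a /pointed_exp eqxx (negbTE vj) (negbTE vk) /= !mul0r.
exists (fun F => (F == [set v; j])%:R); split.
- move=> F _ h; case: eqP => // eF; case: h; apply: hneg; rewrite eF; exact: set21.
- by move=> F hF /(dface_card (leqnn 3) hF).
case=> w hw1 hw2.
have w0 l : v != l -> w [set l] = 0.
  by move=> vl; apply: hw1; rewrite ?cards1 // => /neg_in_mem /(_ av); rewrite inE (negbTE vl).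
have := hw2 [set v; k]; rewrite cards2 vk => /(_ erefl dvk).
have := hw2 [set v; j]; rewrite cards2 vj => /(_ erefl dvj).
rewrite !scal_d2 // eqxx (w0 _ vj) (w0 _ vk) => h1 /eqP.
have -> : [set v; k] == [set v; j] = false.
  apply/negbTE; apply: contraNneq jk => E; have := set22 v j; rewrite -E !inE.
  by rewrite (eq_sym j v) (negbTE vj).
rewrite eq_sym mulf_eq0 signr_eq0 sub0r oppr_eq0 /= => /eqP w0v.
by move/eqP: h1; rewrite w0v subrr mulr0 oner_eq0.
Qed.

(** The vertices [i] and [k] are in the degree complex and cannot be connected in
    it, because no edge leaves [{i, j}]. *)
Lemma H1_of_split i j k : (forall x y, e x y -> (x \in [set i; j]) = (y \in [set i; j])) ->
  k \notin [set i; j] -> exists2 a, total a = 2 * n%:Z - 2 & H a 1.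
Proof.
move=> he hk; have ki : k != i by apply: contraNneq hk => ->; rewrite set21.
exists (pointed_exp i k k (n%:Z - 1) (n%:Z - 1) 0); first by rewrite total_pointed; lia.
set a := pointed_exp _ _ _ _ _ _.
have hneg F : neg_in a F.
  by move=> l _; rewrite /a /pointed_exp; case: (l == i); case: (l == k) => /=; lia.
have di : dface a [set i].
  apply: (deg_faceI (subxx _)) => //; first by rewrite /graph_face cards1.
  by rewrite weight_pointed /outside !inE eqxx ki /=; lia.
have dk : dface a [set k].
  apply: (deg_faceI (subxx _)) => //; first by rewrite /graph_face cards1.
  by rewrite weight_pointed /outside !inE eqxx (eq_sym i) ki /=; lia.
exists (fun F => (F \subset [set i; j])%:R); split.
- by move=> F _ /(_ (hneg F)).
- move=> F hF hd; have [x xF] : exists x, x \in F by apply/card_gt0P; rewrite hF.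
  have [y yx eF] := set2_other hF xF; rewrite eq_sym in yx; rewrite eF in hd *.
  have /andP [/he exy _] := dface_deg_edge yx hd.
  by rewrite scal_d2 // !sub1set exy subrr mulr0.
case=> w _ hw; have := hw _ (cards1 k) dk; have := hw _ (cards1 i) di.
rewrite !scal_d1 !sub1set set21 (negbTE hk) => <- /eqP.
by rewrite eq_sym oner_eq0.
Qed.

End Bounds.

(** * Geometric regularity and the girth *)

Lemma is_max_exists (A : int -> Prop) (B : int) :
  (forall t, A t -> t <= B) -> exists m, is_max A m.
Proof.
move=> hB; have [[t0 At0]|none] := classic (exists t, A t); last first.
  by exists None => t At; apply: none; exists t.
have [d hd] : exists d : nat, forall t, A t -> t <= t0 + d%:Z.
  by exists `|B - t0|%N => t /hB; have := hB _ At0; lia.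
elim: d => [|d IH] in t0 At0 hd *.
  by exists (Some t0); split=> // t /hd; rewrite addr0.
have [Atop|nAtop] := classic (A (t0 + d.+1%:Z)).
  by exists (Some (t0 + d.+1%:Z)).
apply: (IH t0) => // t At; have := hd _ At.
by rewrite le_eqVlt => /predU1P [et|]; [rewrite -et in nAtop | lia].
Qed.

(** A uniform upper bound on [t + i] gives the existence of all the [a_i], so that
    it remains to see that the bound is attained. *)
Lemma is_gregI (K : fieldType) r (J : {mpoly K[r]} -> Prop) (v : int) :
  (forall i t, (0 < i)%N -> lc_neq0 J i t -> t + i%:Z <= v) ->
  (exists2 i, (0 < i)%N & lc_neq0 J i (v - i%:Z)) ->
  is_greg J (Some v).
Proof.
move=> ub [i0 i0_gt0 attained].
have ha i : exists o, (0 < i)%N -> is_a_inv J i o.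
  have [i_gt0|_] := boolP (0 < i)%N; last by exists None.
  have [o ho] : exists o, is_max (lc_neq0 J i) o.
    by apply: (@is_max_exists _ (v - i%:Z)) => t /(ub _ _ i_gt0); lia.
  by exists o.
pose a i := proj1_sig (constructive_indefinite_description _ (ha i)).
have aP i : (0 < i)%N -> is_a_inv J i (a i).
  by rewrite /a; case: constructive_indefinite_description.
exists a => //; split.
  have := aP i0 i0_gt0; rewrite /is_a_inv /is_max.
  case ai: (a i0) => [b|]; last by move/(_ _ attained).
  case=> hb /(_ _ attained) le; exists i0, b; split=> //.
  by have := ub _ _ i0_gt0 hb; lia.
move=> t [i [b [i_gt0 ai ->]]]; have := aP i i_gt0; rewrite ai => -[hb _].
exact: ub hb.
Qed.

Section Cycles.
Variables (r : nat) (e : rel 'I_r).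
Hypotheses (e_irr : irreflexive e) (e_sym : ssrbool.symmetric e).

Lemma has_cycleP k : reflect
  (exists c : seq 'I_r, [/\ uniq c, cycle e c, size c = k & (3 <= k)%N])
  (has_cycle e k).
Proof.
apply: (iffP andP) => [[k3 /existsP [c /andP [h1 h2]]]|[c [h1 h2 <- h4]]].
  by exists c; rewrite size_tuple.
by split=> //; apply/existsP; exists (in_tuple c); rewrite /ucycleb h1 h2.
Qed.

Lemma has_cycle_size k : has_cycle e k -> (k <= r)%N.
Proof.
case/has_cycleP => c [uc _ <- _]; rewrite -(card_uniqP uc).
by rewrite -[r in (_ <= r)%N]card_ord max_card.
Qed.

Lemma ohead_filter_iota (P : pred nat) m l :
  if ohead [seq k <- iota m l | P k] is Some g
  then P g /\ forall k, (m <= k < g)%N -> ~~ P k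
  else forall k, (m <= k < m + l)%N -> ~~ P k.
Proof.
elim: l m => [|l IH] m /=; first by move=> k; lia.
have [Pm|nPm] := boolP (P m); first by split=> // k; lia.
have := IH m.+1; case: ohead => [g [Pg h]|h].
  split=> // k hk; case: (eqVneq k m) => [-> //|km]; apply: h; lia.
by move=> k hk; case: (eqVneq k m) => [-> //|km]; apply: h; lia.
Qed.

Lemma girth_Some g : girth e = Some g ->
  has_cycle e g /\ forall k, (k < g)%N -> ~~ has_cycle e k.
Proof.
move=> eg; have := ohead_filter_iota (has_cycle e) 0 r.+1.
by rewrite -/(girth e) eg => -[h1 h2]; split=> // k; apply: h2.
Qed.

Lemma girth_None k : girth e = None -> ~~ has_cycle e k.
Proof.
move=> eg; have := ohead_filter_iota (has_cycle e) 0 r.+1.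
rewrite -/(girth e) eg => h; apply/negP => hk.
by move: (h k); rewrite hk add0n ltnS (has_cycle_size hk) => /(_ isT).
Qed.

Lemma triangle_free_of_cycle : ~~ has_cycle e 3 -> triangle_free e.
Proof.
move=> h x y t exy eyt; apply: contra h => ext.
have xy := adj_neq e_irr exy; have yt := adj_neq e_irr eyt; have xt := adj_neq e_irr ext.
apply/has_cycleP; exists [:: x; y; t]; split=> //=.
  by rewrite !inE negb_or xy xt yt.
by rewrite exy eyt e_sym ext.
Qed.

Lemma c4_free_of_cycle : ~~ has_cycle e 4 -> c4_free e.
Proof.
move=> h i j k k' ij eik ejk eik' ejk'; apply/eqP; apply: contraNT h => kk'.
apply/has_cycleP; exists [:: i; k; j; k']; split=> //=.
  rewrite !inE !negb_or ij kk' (adj_neq e_irr eik) (adj_neq e_irr eik').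
  by rewrite [k == j]eq_sym (adj_neq e_irr ejk) (adj_neq e_irr ejk').
by rewrite eik e_sym ejk ejk' e_sym eik'.
Qed.

Lemma path_of_cycle k : has_cycle e k ->
  exists v i j, [/\ e v i, e v j & i != j].
Proof.
case/has_cycleP => -[|x [|y [|t c]]] [uc gc <-] // _.
move: gc => /= /and3P [exy eyt _]; exists y, x, t; split=> //.
  by rewrite e_sym.
by move: uc => /= /andP []; rewrite !inE !negb_or => /and3P [].
Qed.

Lemma graph_deg_path : (2 <= graph_deg e)%N <->
  exists v i j, [/\ e v i, e v j & i != j].
Proof.
split=> [h|[v [i [j [evi evj ij]]]]]; last first.
  apply: leq_trans (leq_bigmax v); apply/card_gt1P; exists i, j.
  by rewrite !inE.
apply: NNPP => hno; move: h; rewrite leqNgt ltnS => /negP; apply.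
apply/bigmax_leqP => v _; rewrite leqNgt; apply/negP => /card_gt1P [i [j]].
by rewrite !inE => -[evi evj ij]; apply: hno; exists v, i, j.
Qed.

End Cycles.

Section Main.
Variables (K : fieldType) (r : nat) (e : rel 'I_r) (n : nat).
Hypotheses (e_irr : irreflexive e) (e_sym : ssrbool.symmetric e) (n_gt0 : (0 < n)%N).
Local Notation J := (ideal_pow (sr_ideal e (K := K)) n).

Lemma lc_neq0_iff i t : lc_neq0 J i t <->
  exists2 a, total a = t & cohom_neq0 K (in_pow e n) a i.
Proof.
have MD := @in_powD r e n; have JM := @ideal_powP r e K n.
split; first by apply: (cohom_of_lc_neq0 MD JM).
by case=> a; apply: (lc_neq0_of_cohom MD JM).
Qed.

(** The degrees with a negative coordinate contribute at most [2n - 1], hence the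
    assumption on [v]; only the vertex inequalities and the cycles remain. *)
Lemma is_greg_of_bounds (v : int) :
  2 * n%:Z - 1 <= v ->
  (forall a : 'I_r -> int, H1_bounds e n a -> total a + 1 <= v) ->
  (forall (a : 'I_r -> int) (c : seq 'I_r), (forall l, 0 <= a l) -> uniq c -> cycle (deg_edge e n a) c ->
    has_cycle e (size c) -> total a + 2 <= v) ->
  (exists i a, [/\ (0 < i)%N, total a = v - i%:Z & cohom_neq0 K (in_pow e n) a i]) ->
  is_greg J (Some v).
Proof.
move=> hv h1 h2 [i0 [a0 [i0_gt0 ta0 ha0]]]; apply: is_gregI; last first.
  by exists i0 => //; apply/lc_neq0_iff; exists a0.
move=> i t i_gt0 /lc_neq0_iff [a <- ha].
have i_le2 := H_le2 ha.
have [ei|ei] : i = 1%N \/ i = 2 by lia.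
  by subst i; apply: h1; apply: H1_bounded ha.
subst i; case: (H2_bound e_irr e_sym n_gt0 ha) => [|[apos [c [uc gc c3]]]]; first by lia.
apply: (h2 a c) => //; apply/has_cycleP; exists c; split=> //.
by apply: sub_cycle gc => x y /andP [].
Qed.

Lemma has_cycle_ge3 k : has_cycle e k -> (3 <= k)%N.
Proof. by case/andP. Qed.

Lemma pointed_exp_ge0 x y z (c1 c2 c3 : int) : 0 <= c1 -> 0 <= c2 -> 0 <= c3 ->
  forall l : 'I_r, 0 <= pointed_exp x y z c1 c2 c3 l.
Proof. by move=> ? ? ? l; rewrite /pointed_exp !addr_ge0 // mulr_ge0. Qed.

Lemma greg_girth3 : girth e = Some 3 -> is_greg J (Some (3 * n%:Z - 1)).
Proof.
case/girth_Some => h3 _; apply: is_greg_of_bounds; first by lia.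
- by move=> a [h _ _]; lia.
- move=> a c apos uc gc /has_cycle_ge3; rewrite leq_eqVlt => /predU1P [c3|c4].
    by have := cycle3_bound n_gt0 apos uc gc (esym c3); lia.
  by have := cycle4_bound n_gt0 apos uc gc c4; lia.
case/has_cycleP: h3 => c [+ + + _]; case: c => [|x [|y [|z [|t c]]]] // uc gc _.
exists 2, (pointed_exp x y z (n%:Z - 1) (n%:Z - 1) (n%:Z - 1)); split=> //.
  by rewrite total_pointed; lia.
apply: (@H2_of_cycle K r e n e_irr e_sym _ [:: x; y; z]) => //.
  by apply: pointed_exp_ge0; lia.
move: uc gc; rewrite /= !inE !negb_or !andbT => /andP [/andP [xy xz] yz].
rewrite /deg_edge !weight_pointed /outside !inE !eqxx (eq_sym z x) (eq_sym y x) (eq_sym z y).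
rewrite (negbTE xy) (negbTE xz) (negbTE yz) /=.
by case/and3P => -> -> -> /=; apply/and3P; split; lia.
Qed.

Lemma greg_girth4 : girth e = Some 4 -> is_greg J (Some (2 * n%:Z)).
Proof.
case/girth_Some => h4 /(_ 3 isT) h3; apply: is_greg_of_bounds; first by lia.
- by move=> a [_ /(_ (triangle_free_of_cycle e_irr e_sym h3)) h _]; lia.
- move=> a c apos uc gc hc; have c4 : (4 <= size c)%N.
    have := has_cycle_ge3 hc; rewrite leq_eqVlt => /predU1P [c3|//].
    by rewrite -c3 (negbTE h3) in hc.
  by have := cycle4_bound n_gt0 apos uc gc c4; lia.
case/has_cycleP: h4 => c [+ + + _]; case: c => [|x [|y [|z [|t [|u c]]]]] // uc gc _.
exists 2, (pointed_exp x z z (n%:Z - 1) (n%:Z - 1) 0); split=> //.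
  by rewrite total_pointed; lia.
apply: (@H2_of_cycle K r e n e_irr e_sym _ [:: x; y; z; t]) => //.
  by apply: pointed_exp_ge0; lia.
move: uc gc; rewrite /= !inE !negb_or !andbT -!andbA => /and5P [xy xz xt yz].
case/andP=> yt zt; rewrite /deg_edge !weight_pointed /outside !inE !eqxx (eq_sym z x) (eq_sym z y).
rewrite (negbTE xy) (negbTE xz) (negbTE yz) (negbTE xt) (negbTE zt) /=.
by case/and4P => -> -> -> -> /=; apply/and4P; split; lia.
Qed.

(** The value [2n - 1] is common to the graphs of girth at least 5 with [n >= 2]
    and to the forests; only the class attaining it depends on the graph. *)
Lemma greg_long_cycles :
  (forall k, has_cycle e k -> (5 <= k)%N && (2 <= n)%N) ->
  (exists i a, [/\ (0 < i)%N, total a = 2 * n%:Z - 1 - i%:Z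
    & cohom_neq0 K (in_pow e n) a i]) ->
  is_greg J (Some (2 * n%:Z - 1)).
Proof.
move=> hcyc; have h3 : ~~ has_cycle e 3 by apply/negP => /hcyc.
have h4 : ~~ has_cycle e 4 by apply/negP => /hcyc.
apply: is_greg_of_bounds => //.
- move=> a [_ _ /(_ (triangle_free_of_cycle e_irr e_sym h3) (c4_free_of_cycle e_irr e_sym h4))].
  by lia.
- move=> a c apos uc gc /hcyc /andP [c5 n2].
  by have := cycle5_bound apos n2 uc gc c5; lia.
Qed.

Lemma greg_of_path : (forall k, has_cycle e k -> (5 <= k)%N && (2 <= n)%N) ->
  (2 <= graph_deg e)%N -> is_greg J (Some (2 * n%:Z - 1)).
Proof.
move=> hcyc /graph_deg_path [v [i [j [evi evj ij]]]].
apply: greg_long_cycles => //.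
have [a ta ha] := H2_of_path K e_irr e_sym n_gt0 evi evj ij.
by exists 2, a; split=> //; lia.
Qed.

Lemma greg_matching : (3 <= r)%N -> (exists i j, e i j) -> graph_deg e = 1%N ->
  is_greg J (Some (2 * n%:Z - 1)).
Proof.
move=> r3 [i [j eij]] deg1; apply: greg_long_cycles.
  by move=> k /(path_of_cycle e_sym) /graph_deg_path; rewrite deg1.
have inj v x y : e v x -> e v y -> x = y.
  move=> evx evy; apply/eqP; apply: contraT => xy.
  suff : (2 <= graph_deg e)%N by rewrite deg1.
  by apply/graph_deg_path; exists v, x, y.
have closed x y : e x y -> x \in [set i; j] -> y \in [set i; j].
  move=> exy; rewrite !inE => /orP [] /eqP ex; subst x.
    by rewrite (inj _ _ _ exy eij) eqxx orbT.
  by rewrite (inj j y i) ?eqxx // e_sym.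
have [k hk] : exists k, k \notin [set i; j].
  apply/existsP; rewrite -negb_forall; apply/negP => /forallP all_ij.
  have : (r <= 2)%N; last by rewrite leqNgt r3.
  rewrite -[r]card_ord; apply: (@leq_trans #|[set i; j]|).
    by apply: subset_leq_card; apply/subsetP => x _; apply: all_ij.
  by rewrite cards2; case: (i != j).
have [|a ta ha] := H1_of_split K e_irr e_sym n_gt0 _ hk.
  move=> x y exy; apply/idP/idP; first exact: closed exy.
  by apply: closed; rewrite e_sym.
by exists 1%N, a; split=> //; lia.
Qed.

Lemma greg_girth5_pow1 g : girth e = Some g -> (5 <= g)%N -> n = 1%N ->
  is_greg J (Some (2 : int)).
Proof.
case/girth_Some => hg hlt g5 n1.
have h3 := hlt 3 (leq_trans (isT : (3 < 5)%N) g5).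
have h4 := hlt 4 g5.
apply: is_greg_of_bounds; first by lia.
- move=> a [_ _ /(_ (triangle_free_of_cycle e_irr e_sym h3) (c4_free_of_cycle e_irr e_sym h4))].
  by lia.
- move=> a c apos uc gc hc; have c5 : (4 <= size c)%N.
    by apply: leq_trans (ltnW g5) _; rewrite leqNgt; apply/negP => /hlt; rewrite hc.
  by have := cycle4_bound n_gt0 apos uc gc c5; lia.
case/has_cycleP: hg => -[|x c] [uc gc hc g3]; first by rewrite -hc in g3.
exists 2, (pointed_exp x x x 0 0 0); split=> //; first by rewrite total_pointed.
apply: (@H2_of_cycle K r e n e_irr e_sym _ (x :: c)) => //; last by rewrite hc.
by apply: sub_cycle gc => u v euv; rewrite /deg_edge euv weight_pointed !mul0r n1.
Qed.

End Main.

Theorem theorem4p1 (K : fieldType) (r : nat) (hr : (3 <= r)%N)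
    (e : rel 'I_r) (e_sym : ssrbool.symmetric e) (e_irr : irreflexive e)
    (e_edge : exists i j : 'I_r, e i j)
    (n : nat) (hn : (1 <= n)%N) :
  [/\ girth e = Some 3%N ->
        is_greg (ideal_pow (sr_ideal e (K := K)) n) (Some (3 * n%:Z - 1)),
      girth e = Some 4%N ->
        is_greg (ideal_pow (sr_ideal e (K := K)) n) (Some (2 * n%:Z)),
      (forall g : nat, girth e = Some g -> (5 <= g)%N ->
        ((2 <= n)%N ->
          is_greg (ideal_pow (sr_ideal e (K := K)) n) (Some (2 * n%:Z - 1))) /\
        (n = 1%N ->
          is_greg (ideal_pow (sr_ideal e (K := K)) n) (Some (2 : int)))),
      girth e = None -> (2 <= graph_deg e)%N ->
        is_greg (ideal_pow (sr_ideal e (K := K)) n) (Some (2 * n%:Z - 1))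
    & graph_deg e = 1%N ->
        is_greg (ideal_pow (sr_ideal e (K := K)) n) (Some (2 * n%:Z - 1))].
Proof.
split.
- exact: greg_girth3.
- exact: greg_girth4.
- move=> g eg g5; split=> [n2|]; last exact: greg_girth5_pow1 eg g5.
  have [hg hlt] := girth_Some eg.
  apply: greg_of_path => //; last exact/graph_deg_path/(path_of_cycle e_sym hg).
  move=> k hk; rewrite n2 andbT (leq_trans g5) // leqNgt.
  by apply/negP => /hlt; rewrite hk.
- move=> eg; apply: greg_of_path => // k.
  by rewrite (negbTE (girth_None k eg)).
- exact: greg_matching.
Qed.
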